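(* Let $X$ be one of the types $\mathsf{B}_n$, $\mathsf{C}_n$, $\mathsf{F}_4$, $\mathsf{G}_2$, let $p=3$ if $X=\mathsf{G}_2$ and $p=2$ otherwise, and let $K\subsetneq L$ be fields of characteristic $p$ with $L^p\subseteq K$. Then \[ T(K,L)=\bigl\langle \{h_r(t)\mid r\in\Phi_l,\ t\in K^\times\}\cup\{h_r(t)\mid r\in\Phi_s,\ t\in L^\times\}\bigr\rangle \] holds if and only if $X$ is of type $\mathsf{G}_2$, of type $\mathsf{F}_4$, or of type $\mathsf{B}_n$ with $n$ odd. In these cases, moreover, \[ X(K,L)=\bigl\langle \{u_r(s)\mid r\in\Phi_l,\ s\in K\}\cup\{u_r(t)\mid r\in\Phi_s,\ t\in L\}\bigr\rangle. \]
   Context: Let $\Phi$ be a root system of type $X$, with long roots $\Phi_l$ and short roots $\Phi_s$. Let $X(L)$ be the adjoint Chevalley group of type $X$ over $L$, generated by root elements $u_r(t)$ ($r\in\Phi$, $t\in L$). Put $n_r(t)=u_r(t)u_{-r}(-t^{-1})u_r(t)$ and $h_r(t)=n_r(t)n_r(-1)$ for $t\in L^\times$, and let $T(L)=\langle h_r(t)\mid r\in\Phi,t\in L^\times\rangle$ (the standard maximal split torus). For $h\in T(L)$ and $r\in\Phi$, $r(h)\in L^\times$ denotes the scalar with $h u_r(t)h^{-1}=u_r(r(h)t)$ for all $t$. Define $T(K,L)=\{h\in T(L)\mid r(h)\in K \text{ for all } r\in\Phi_l\}$ and the mixed group $X(K,L)=\langle T(K,L)\cup\{u_r(s)\mid r\in\Phi_l,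 s\in K\}\cup\{u_r(t)\mid r\in\Phi_s,t\in L\}\rangle$. *)

(* Defs.v *)
From HB Require Import structures.
From mathcomp Require Import all_boot all_order all_algebra.
Set Implicit Arguments. Unset Strict Implicit. Unset Printing Implicit Defensive.
Import Order.TTheory GRing.Theory Num.Theory.
Local Open Scope ring_scope.

(* Root systems of types B_n, C_n, F_4, G_2, realised concretely as    *)
(* integer vectors (seq int) in a Euclidean space with the standard    *)
(* dot product (F_4 is scaled by 2 so that all coordinates are ints).  *)

Inductive ctype := TB of nat | TC of nat | TF4 | TG2.

Definition ctype_eqb (x y : ctype) : bool :=
  match x, y with
  | TB n, TB m => n == m | TC n, TC m => n == m
  | TF4, TF4 => true | TG2, TG2 => true | _, _ => false end.

Definition valid_type (X : ctype) : Prop :=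
  match X with TB n => (2 <= n)%N | TC n => (2 <= n)%N | _ => True end.

Definition addv (u v : seq int) : seq int := [seq p.1 + p.2 | p <- zip u v].
Definition scalev (a : int) (u : seq int) : seq int := [seq a * x | x <- u].
Definition oppv (u : seq int) : seq int := scalev (-1) u.
Definition subv (u v : seq int) : seq int := addv u (oppv v).
Definition dotv (u v : seq int) : int := \sum_(p <- zip u v) p.1 * p.2.

Definition ev (m i : nat) : seq int := mkseq (fun k => if k == i then 1 else 0) m.
Definition pm : seq int := [:: 1; -1].
Definition signs2 : seq (int * int) := [seq (a, b) | a <- pm, b <- pm].
Definition pairs (n : nat) : seq (nat * nat) :=
  [seq ij <- [seq (i, j) | i <- iota 0 n, j <- iota 0 n] | (ij.1 < ij.2)%N].
Definition dd (n : nat) : seq (seq int) :=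
  [seq addv (scalev ab.1 (ev n ij.1)) (scalev ab.2 (ev n ij.2))
     | ij <- pairs n, ab <- signs2].
Definition axial (n : nat) (k : int) : seq (seq int) :=
  [seq scalev (s * k) (ev n i) | i <- iota 0 n, s <- pm].
Definition consAll (s : seq (seq int)) : seq (seq int) := [seq a :: u | a <- pm, u <- s].
Definition halfs4 : seq (seq int) := consAll (consAll (consAll (consAll [:: [::]]))).

Definition rootsys (X : ctype) : seq (seq int) :=
  match X with
  | TB n => axial n 1 ++ dd n
  | TC n => axial n 2 ++ dd n
  | TF4 => map (scalev 2) (dd 4) ++ axial 4 2 ++ halfs4
  | TG2 => [:: [:: 1; -1; 0]; [:: -1; 1; 0]; [:: 1; 0; -1]; [:: -1; 0; 1];
              [:: 0; 1; -1]; [:: 0; -1; 1];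
              [:: 2; -1; -1]; [:: -2; 1; 1]; [:: -1; 2; -1]; [:: 1; -2; 1];
              [:: -1; -1; 2]; [:: 1; 1; -2]]
  end.

Definition rank (X : ctype) : nat :=
  match X with TB n => n | TC n => n | TF4 => 4 | TG2 => 2 end.

Definition simples (X : ctype) : seq (seq int) :=
  match X with
  | TB n => [seq subv (ev n i) (ev n i.+1) | i <- iota 0 n.-1] ++ [:: ev n n.-1]
  | TC n => [seq subv (ev n i) (ev n i.+1) | i <- iota 0 n.-1] ++ [:: scalev 2 (ev n n.-1)]
  | TF4 => [:: [:: 0; 2; -2; 0]; [:: 0; 0; 2; -2]; [:: 0; 0; 0; 2]; [:: 1; -1; -1; -1]]
  | TG2 => [:: [:: 1; -1; 0]; [:: -2; 1; 1]]
  end.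

Definition simple_root (X : ctype) (i : 'I_(rank X)) : seq int := nth [::] (simples X) i.

Definition cartan (b a : seq int) : int := ((2 * dotv b a) %/ dotv a a)%Z.

Definition rootT (X : ctype) := seq_sub (rootsys X).

Definition oppR (X : ctype) (r : rootT X) : rootT X := insubd r (oppv (val r)).

Definition is_long (X : ctype) (r : rootT X) : bool :=
  [forall s : rootT X, dotv (val s) (val s) <= dotv (val r) (val r)].

(* p such that s - p r is the start of the r-string through s *)
Definition pstr (X : ctype) (r s : rootT X) : nat :=
  \sum_(1 <= k < 5) ((subv (val s) (scalev k%:Z (val r)) \in rootsys X) : nat).

(* Chevalley basis of the Lie algebra: basis h_1..h_l (h_i = h_{a_i}, *)
(* a_i simple_root) and e_r (r a root).  The data are the structure        *)
(* constants N r s ([e_r,e_s] = N r s e_{r+s}) and the coordinates     *)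
(* c r i of h_r = [e_r, e_{-r}] in the basis h_i.                      *)

Definition idx (X : ctype) := ('I_(rank X) + rootT X)%type.

Definition br (X : ctype) (N : rootT X -> rootT X -> int)
  (c : rootT X -> 'I_(rank X) -> int) (a b : idx X) : idx X -> int :=
  match a, b with
  | inl _, inl _ => fun _ => 0
  | inl i, inr s => fun z => if z == inr s then cartan (val s) (simple_root i) else 0
  | inr s, inl i => fun z => if z == inr s then - cartan (val s) (simple_root i) else 0
  | inr r, inr s => fun z =>
      if val s == oppv (val r) then
        (match z with inl i => c r i | inr _ => 0 end)
      else if addv (val r) (val s) \in rootsys X then
        (match z with inr u => if val u == addv (val r) (val s) then N r s else 0
                    | inl _ => 0 end)
      else 0
  end.

Definition is_chevalley_basis (X : ctype) (N : rootT X -> rootT X -> int)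
  (c : rootT X -> 'I_(rank X) -> int) : Prop :=
  (* h_r = sum_i c r i h_i, i.e. r^vee = sum_i c r i a_i^vee (tested on all rootsys) *)
  (forall r b : rootT X,
      \sum_(i < rank X) c r i * cartan (val b) (simple_root i) = cartan (val b) (val r)) /\
  (forall a b z : idx X, br N c a b z = - br N c b a z) /\
  (forall a b e z : idx X,
      \sum_(k : idx X) (br N c b e k * br N c a k z + br N c e a k * br N c b k z
                        + br N c a b k * br N c e k z) = 0) /\
  (forall r s : rootT X, addv (val r) (val s) \in rootsys X ->
      N (oppR r) (oppR s) = - N r s) /\
  (forall r s : rootT X, addv (val r) (val s) \in rootsys X ->
      N r s = (pstr r s).+1%:Z \/ N r s = - (pstr r s).+1%:Z).

Definition dimg (X : ctype) : nat := #|{: idx X}|.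

(* matrix of ad e_r on the Z-form (columns = images of basis vectors) *)
Definition adM (X : ctype) N c (r : rootT X) : 'M[int]_(dimg X) :=
  \matrix_(i, j) br N c (inr r) (enum_val j) (enum_val i).

(* (ad e_r)^k / k!, integral *)
Definition adDiv (X : ctype) N c (r : rootT X) (k : nat) : 'M[int]_(dimg X) :=
  \matrix_(i, j) (((adM N c r ^+ k) i j) %/ (k`!)%:Z)%Z.

(* root element u_r(t) = exp(t ad e_r) acting on g_L = g_Z (x) L *)
Definition ur (X : ctype) N c (L : fieldType) (r : rootT X) (t : L) : 'M[L]_(dimg X) :=
  \sum_(k < dimg X) t ^+ k *: map_mx (fun z : int => z%:~R) (adDiv N c r k).

Definition nr (X : ctype) N c (L : fieldType) (r : rootT X) (t : L) : 'M[L]_(dimg X) :=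
  ur N c r t *m ur N c (oppR r) (- t^-1) *m ur N c r t.

Definition hr (X : ctype) N c (L : fieldType) (r : rootT X) (t : L) : 'M[L]_(dimg X) :=
  nr N c r t *m nr N c r (-1).

Inductive gengrp (L : fieldType) (d : nat) (S : 'M[L]_d -> Prop) : 'M[L]_d -> Prop :=
  | gen_one : gengrp S 1%:M
  | gen_in g : S g -> gengrp S g
  | gen_mul g h : gengrp S g -> gengrp S h -> gengrp S (g *m h)
  | gen_inv g : gengrp S g -> gengrp S (invmx g).

Definition TL (X : ctype) N c (L : fieldType) : 'M[L]_(dimg X) -> Prop :=
  gengrp (fun g => exists (r : rootT X) (t : L), t != 0 /\ g = hr N c r t).

Definition TKL (X : ctype) N c (L : fieldType) (K : {pred L}) (h : 'M[L]_(dimg X)) : Prop :=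
  TL N c h /\
  forall r : rootT X, is_long r ->
    exists2 a : L, a \in K &
      forall t : L, h *m ur N c r t *m invmx h = ur N c r (a * t).

Definition Tgen (X : ctype) N c (L : fieldType) (K : {pred L}) : 'M[L]_(dimg X) -> Prop :=
  gengrp (fun g => exists (r : rootT X) (t : L),
         t != 0 /\ (is_long r ==> (t \in K)) /\ g = hr N c r t).

Definition XKL (X : ctype) N c (L : fieldType) (K : {pred L}) : 'M[L]_(dimg X) -> Prop :=
  gengrp (fun g => TKL N c K g \/
         exists (r : rootT X) (t : L),
           (is_long r ==> (t \in K)) /\ g = ur N c r t).

Definition Ugen (X : ctype) N c (L : fieldType) (K : {pred L}) : 'M[L]_(dimg X) -> Prop :=
  gengrp (fun g => exists (r : rootT X) (t : L),
         (is_long r ==> (t \in K)) /\ g = ur N c r t).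

Definition char_of (X : ctype) : nat := if X is TG2 then 3 else 2.

(* Main.v *)
(* Relative to a root r, every basis vector e_s lies in an sl_2-string of length at most 4 on which
   the divided powers of ad e_r and ad e_{-r} act by binomial coefficients; the string structure
   comes from the commutator [e_r, e_{-r}] = h_r alone.  Computing n_r(t) n_r(-1) on strings shows
   that h_r(t) is the diagonal matrix with entries t^<s, r^vee>, so T(L) is a group of characters
   of the root lattice, all of the form s |-> prod_i t_i^<s, a_i^vee>.  A short coroot takes values
   divisible by p on long roots, so membership in T(K,L) only constrains the t_i with a_i long, and
   for G_2, F_4 and B_n with n odd the constraints force these t_i into K.  For x outside K,
   the character x^(sum of coordinates) for B_n with n even, and h_r(x) with r long for C_n,
   lie in T(K,L); the value at e_1 (resp. the product of the values at all 2e_i, modulo squares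
   from K) separates them from the group generated by the h_r. *)

Require Import Defs.
From HB Require Import structures.
From mathcomp Require Import all_boot all_order all_algebra.
From mathcomp Require Import zify ring lra.
(* [vector] also exports an [addv]. *)
Import Defs.
Set Implicit Arguments. Unset Strict Implicit. Unset Printing Implicit Defensive.
Import Order.TTheory GRing.Theory Num.Theory.
Local Open Scope ring_scope.

(** * Vectors and root systems *)

(** The dichotomy is the vanishing of a determinant modulo p. Since p-th powers lie in K, the units
    of L modulo those of K form a vector space over F_p. At a long simple root a_k, the condition on
    the parameters t_i becomes, written additively in this space, the vanishing of the sum of <a_k,
    a_i^vee> t_i over the long a_i. Its matrix is the Cartan matrix of the long simple roots, of
    type A_1, A_2, A_{n-1}, A_1 for G_2, F_4, B_n, C_n, with determinant 2, 3, n, 2. Modulo p it is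
    invertible exactly for G_2, F_4 and B_n with n odd; in the other cases a kernel vector gives the
    counterexample.

    Two obstacles shape the way there. The factorials 2! and 3! may vanish in L, so divided powers
    are computed on integral vectors, where factorials cancel, and only the result is mapped to L. A
    Chevalley basis fixes its structure constants only up to sign; the signs are absorbed into the
    vectors chosen along each string. *)

Lemma nth_addv (u v : seq int) i : size u = size v -> nth 0 (addv u v) i = nth 0 u i + nth 0 v i.
Proof.
move=> e; have [li|li] := ltnP i (size u).
  by rewrite (nth_map (0, 0)) ?size_zip -?e ?minnn // nth_zip.
by rewrite !nth_default ?size_map ?size_zip -?e ?minnn // addr0.
Qed.

Lemma nth_scalev a (u : seq int) i : nth 0 (scalev a u) i = a * nth 0 u i.
Proof.
have [li|li] := ltnP i (size u); first by rewrite (nth_map 0).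
by rewrite !nth_default ?size_map // mulr0.
Qed.

Lemma size_addv (u v : seq int) : size u = size v -> size (addv u v) = size u.
Proof. by move=> e; rewrite size_map size_zip -e minnn. Qed.

Lemma size_scalev a (u : seq int) : size (scalev a u) = size u.
Proof. by rewrite size_map. Qed.

Lemma dotvE (u v : seq int) : size u = size v -> dotv u v = \sum_(i < size u) nth 0 u i * nth 0 v i.
Proof.
move=> e; rewrite /dotv (big_nth (0, 0)) size_zip -e minnn big_mkord.
by apply: eq_bigr => i _; rewrite nth_zip.
Qed.

Lemma dotvDl (u v w : seq int) : size u = size w -> size v = size w ->
  dotv (addv u v) w = dotv u w + dotv v w.
Proof.
move=> eu ev; rewrite !dotvE ?size_addv ?eu ?ev // -big_split /=.
by apply: eq_bigr => i _; rewrite nth_addv ?eu ?ev // mulrDl.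
Qed.

Lemma dotvZl a (u w : seq int) : size u = size w -> dotv (scalev a u) w = a * dotv u w.
Proof.
move=> eu; rewrite !dotvE ?size_scalev // mulr_sumr.
by apply: eq_bigr => i _; rewrite nth_scalev mulrA.
Qed.

Lemma dotvC (u w : seq int) : size u = size w -> dotv u w = dotv w u.
Proof.
move=> eu; rewrite !dotvE // eu.
by apply: eq_bigr => i _; rewrite mulrC.
Qed.

Definition ambient (X : ctype) : nat :=
  match X with TB n => n | TC n => n | TF4 => 4 | TG2 => 3 end.

Lemma vec_ext (u v : seq int) : size u = size v -> (forall i, nth 0 u i = nth 0 v i) -> u = v.
Proof. by move=> e h; apply: (@eq_from_nth _ 0). Qed.

Lemma nth_ev n k i : nth 0 (ev n k) i = ((i == k) && (i < n)%N)%:R.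
Proof.
have [li|li] := ltnP i n; first by rewrite nth_mkseq //; case: (i == k).
by rewrite nth_default ?size_mkseq // andbF.
Qed.

Lemma size_ev n k : size (ev n k) = n. Proof. by rewrite size_mkseq. Qed.

Lemma dotv_ev n k (u : seq int) : size u = n -> (k < n)%N -> dotv u (ev n k) = nth 0 u k.
Proof.
move=> e lk; rewrite dotvE ?size_ev // e (bigD1 (Ordinal lk)) //= nth_ev eqxx lk mulr1.
rewrite big1 ?addr0 // => i ne; rewrite nth_ev.
suff -> : (i == k :> nat) = false by rewrite mulr0.
by apply/negbTE; rewrite -val_eqE in ne.
Qed.

Definition dvec n i j (a b : int) := addv (scalev a (ev n i)) (scalev b (ev n j)).

Lemma size_dvec n i j a b : size (dvec n i j a b) = n.
Proof. by rewrite size_addv !size_scalev !size_ev. Qed.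

Lemma mem_pm a : a \in pm -> a = 1 \/ a = -1.
Proof. by rewrite !inE => /orP[] /eqP ->; [left|right]. Qed.

Lemma mem_axial n k s : reflect (exists i e, [/\ (i < n)%N, e \in pm & s = scalev (e * k) (ev n i)])
  (s \in axial n k).
Proof.
apply: (iffP allpairsP) => [[[i e] /= [hi he ->]]|[i [e [hi he ->]]]].
  by exists i, e; split => //; move: hi; rewrite mem_iota.
by exists (i, e); split => //=; rewrite mem_iota.
Qed.

Lemma mem_dd n s : reflect
  (exists i j a b, [/\ (i < j)%N, (j < n)%N, a \in pm, b \in pm & s = dvec n i j a b])
  (s \in dd n).
Proof.
apply: (iffP allpairsP) => [[[[i j] [a b]] /= [hi he ->]]|[i [j [a [b [lij lj ha hb ->]]]]]].
  move: hi; rewrite mem_filter /= => /andP[lij /allpairsP[[i' j'] /= [hi hj [e1 e2]]]].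
  subst i' j'; move: hi hj; rewrite !mem_iota /= => _ hj.
  move/allpairsP: he => [[a' b'] /= [ha hb [e1 e2]]]; subst a' b'.
  by exists i, j, a, b.
exists ((i, j), (a, b)); split => //=.
  rewrite mem_filter /= lij; apply/allpairsP; exists (i, j) => /=.
  by rewrite !mem_iota /= lj; split => //; apply: ltn_trans lj.
by apply/allpairsP; exists (a, b).
Qed.

Lemma nth_dvec n i j a b k : (i < j)%N -> (j < n)%N ->
  nth 0 (dvec n i j a b) k = a * (k == i)%:R + b * (k == j)%:R.
Proof.
move=> lij lj; rewrite nth_addv ?size_scalev ?size_ev // !nth_scalev !nth_ev.
have li := ltn_trans lij lj.
by case: (eqVneq k i) => [->|ni]; case: (eqVneq k j) => [ej|nj] //=; rewrite ?li ?andbT // ?ej ?lj.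
Qed.

Lemma dotv_dvec n i j a b (u : seq int) : size u = n -> (i < j)%N -> (j < n)%N ->
  dotv u (dvec n i j a b) = a * nth 0 u i + b * nth 0 u j.
Proof.
move=> e lij lj; have li := ltn_trans lij lj.
rewrite dotvC ?size_dvec // dotvDl ?size_scalev ?size_ev // !dotvZl ?size_ev //.
by rewrite !(@dotvC (ev _ _)) ?size_ev // !dotv_ev.
Qed.

Lemma dotv_axv n i a (u : seq int) : size u = n -> (i < n)%N ->
  dotv u (scalev a (ev n i)) = a * nth 0 u i.
Proof.
by move=> e li; rewrite dotvC ?size_scalev ?size_ev // dotvZl ?size_ev // dotvC ?size_ev // dotv_ev.
Qed.

Lemma nth_axv n i a k : (i < n)%N -> nth 0 (scalev a (ev n i)) k = a * (k == i)%:R.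
Proof. by move=> li; rewrite nth_scalev nth_ev; case: eqP => [->|] //=; rewrite li. Qed.

Lemma size_axv n i a : size (scalev a (ev n i)) = n.
Proof. by rewrite size_scalev size_ev. Qed.

Lemma scale1v v : scalev 1 v = v.
Proof. by apply: vec_ext => [|k]; rewrite ?size_scalev // nth_scalev mul1r. Qed.

Lemma subv_ev n j : (j.+1 < n)%N -> subv (ev n j) (ev n j.+1) = dvec n j j.+1 1 (-1).
Proof. by move=> lj; rewrite /dvec scale1v. Qed.

Lemma sum_dvec n i j a b : (i < j)%N -> (j < n)%N ->
  \sum_(k < n) nth 0 (dvec n i j a b) k = a + b.
Proof.
move=> lij lj; have pick l (e : int) : (l < n)%N -> \sum_(k < n) e * (k == l :> nat)%:R = e.
  move=> ll; rewrite (bigD1 (Ordinal ll)) //= eqxx mulr1 big1 ?addr0 // => k ne.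
  by rewrite (_ : (k == l :> nat) = false) ?mulr0 //; apply/negbTE; rewrite -val_eqE in ne.
under eq_bigr do rewrite nth_dvec //.
by rewrite big_split /= !pick //; exact: ltn_trans lj.
Qed.

(* [dotv] is a locked big operator and does not compute. *)
Fixpoint dotf (u v : seq int) : int :=
  match u, v with a :: u', b :: v' => a * b + dotf u' v' | _, _ => 0 end.

Lemma dotf_dotv (u v : seq int) : dotv u v = dotf u v.
Proof.
elim: u v => [|a u IH] [|b v]; rewrite /dotv /= ?big_nil ?big_cons //=.
by rewrite -IH.
Qed.

(** B_n and C_n differ only in the length [k] of the axial roots and are treated together. Sums and
    differences of two coordinates are the pairings with roots of [dd n], single coordinates those
    with axial roots. *)
Lemma bc_bounds n k s : k = 1 \/ k = 2 -> s \in axial n k ++ dd n ->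
  size s = n /\
  (forall i j, i != j -> -2 <= nth 0 s i + nth 0 s j <= 2 /\ -2 <= nth 0 s i - nth 0 s j <= 2) /\
  (forall i, - k <= nth 0 s i <= k).
Proof.
move=> hk; rewrite mem_cat => /orP[/mem_axial|/mem_dd].
  move=> [a [e [la /mem_pm he ->]]]; split; first exact: size_axv.
  by split=> [i j /eqP ne|i]; rewrite !nth_axv //; do ?[case: eqP => ?]; subst;
    case: he => ->; case: hk => ->; lia.
move=> [a [b [e [f [lab lb /mem_pm he /mem_pm hf ->]]]]]; split; first exact: size_dvec.
by split=> [i j /eqP ne|i]; rewrite !nth_dvec //; do ?[case: eqP => ?]; subst; lia.
Qed.

Lemma mem_oppm e : e \in pm -> - e \in pm.
Proof. by move/mem_pm => [] ->; rewrite !inE ?opprK ?eqxx ?orbT. Qed.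

Lemma oppv_axv n i a : (i < n)%N -> oppv (scalev a (ev n i)) = scalev (- a) (ev n i).
Proof.
move=> li; apply: vec_ext => [|k]; rewrite ?size_scalev // !nth_scalev; lia.
Qed.

Lemma oppv_dvec n i j a b : oppv (dvec n i j a b) = dvec n i j (- a) (- b).
Proof.
apply: vec_ext => [|k]; first by rewrite size_scalev !size_dvec.
rewrite nth_scalev !nth_addv ?size_scalev ?size_ev // !nth_scalev; lia.
Qed.

Lemma bc_opp n k s : s \in axial n k ++ dd n -> oppv s \in axial n k ++ dd n.
Proof.
rewrite !mem_cat => /orP[/mem_axial|/mem_dd].
  move=> [a [e [la he ->]]]; apply/orP; left; apply/mem_axial.
  by exists a, (- e); rewrite oppv_axv // mulNr mem_oppm.
move=> [a [b [e [f [lab lb he hf ->]]]]]; apply/orP; right; apply/mem_dd.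
by exists a, b, (- e), (- f); rewrite oppv_dvec !mem_oppm.
Qed.

Lemma dotv_axv_axv n i a : (i < n)%N -> dotv (scalev a (ev n i)) (scalev a (ev n i)) = a * a.
Proof. by move=> li; rewrite dotv_axv ?size_axv // nth_axv // eqxx mulr1. Qed.

Lemma dotv_dvec_dvec n i j a b : (i < j)%N -> (j < n)%N ->
  dotv (dvec n i j a b) (dvec n i j a b) = a * a + b * b.
Proof.
by move=> lij lj; rewrite dotv_dvec ?size_dvec // !nth_dvec // !eqxx; case: eqP => ?; case: eqP => ?; lia.
Qed.

(** Integrality of <s, r^vee> and the bound 3 on its absolute value, cleared of denominators. *)
Definition root_pair_ok (r s : seq int) :=
  [/\ (dotv r r %| 2 * dotv s r)%Z, 2 * dotv s r <= 3 * dotv r r & - (3 * dotv r r) <= 2 * dotv s r].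

Lemma bc_pair n k r s : k = 1 \/ k = 2 -> r \in axial n k ++ dd n -> s \in axial n k ++ dd n ->
  0 < dotv r r /\ root_pair_ok r s.
Proof.
move=> hk + /(bc_bounds hk) [sz [B1 B2]].
rewrite mem_cat /root_pair_ok => /orP[/mem_axial|/mem_dd].
  move=> [a [e [la /mem_pm he ->]]]; rewrite dotv_axv_axv // dotv_axv //.
  have := B2 a; set x := nth 0 s a => Bx.
  have -> : e * k * (e * k) = k * k by case: he => ->; lia.
  split; first by case: hk => ->.
  split; last 2 first; [by case: he Bx => ->; case: hk => ->; lia..|].
  apply/dvdzP; case: hk Bx => -> Bx; first by exists (2 * (e * x)); lia.
  by exists (e * x); lia.
move=> [a [b [e [f [lab lb /mem_pm he /mem_pm hf ->]]]]].
rewrite dotv_dvec_dvec // dotv_dvec //.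
have ne : a != b by rewrite neq_ltn lab.
have [] := B1 _ _ ne; set x := nth 0 s a; set y := nth 0 s b => Bx By.
have -> : e * e + f * f = 2 by case: he => ->; case: hf => ->.
split => //; split; [exact: dvdz_mulr | by case: he => ->; case: hf => ->; lia..].
Qed.

Definition fin_roots_ok (X : ctype) : bool :=
  all (fun r => [&& size r == ambient X, oppv r \in rootsys X, 0 < dotf r r &
    all (fun s => [&& (dotf r r %| 2 * dotf s r)%Z, 2 * dotf s r <= 3 * dotf r r &
       - (3 * dotf r r) <= 2 * dotf s r]) (rootsys X)]) (rootsys X).

Lemma fin_roots_okP X : fin_roots_ok X -> forall r, r \in rootsys X ->
  [/\ size r = ambient X, oppv r \in rootsys X, 0 < dotv r r &
     forall s, s \in rootsys X -> root_pair_ok r s].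
Proof.
move=> /allP h r hr; case/and4P: (h r hr) => /eqP sz op gt /allP pr.
split; rewrite ?dotf_dotv // => s /pr /and3P[? ? ?].
by rewrite /root_pair_ok !dotf_dotv.
Qed.

(** All that the string arguments take from the root system. Reflections do not enter: the shape of
    the strings is recovered from the Lie algebra. *)
Lemma root_facts X r : r \in rootsys X ->
  [/\ size r = ambient X, oppv r \in rootsys X, 0 < dotv r r &
     forall s, s \in rootsys X -> root_pair_ok r s].
Proof.
have bc n k : k = 1 \/ k = 2 -> r \in axial n k ++ dd n ->
  [/\ size r = n, oppv r \in axial n k ++ dd n, 0 < dotv r r &
     forall s, s \in axial n k ++ dd n -> root_pair_ok r s].
  move=> hk hr; split; [exact: (bc_bounds hk hr).1 | exact: bc_opp | exact: (bc_pair hk hr hr).1 |].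
  by move=> s hs; exact: (bc_pair hk hr hs).2.
case: X => [n|n||].
- exact: bc (or_introl erefl).
- exact: bc (or_intror erefl).
- by apply: fin_roots_okP; vm_compute.
- by apply: fin_roots_okP; vm_compute.
Qed.

Section Vectors.
Variable X : ctype.
Implicit Types r s : seq int.
Notation Phi := (rootsys X).

Lemma root_size r : r \in Phi -> size r = ambient X.
Proof. by case/root_facts. Qed.
Lemma root_opp r : r \in Phi -> oppv r \in Phi.
Proof. by case/root_facts. Qed.
Lemma root_gt0 r : r \in Phi -> 0 < dotv r r.
Proof. by case/root_facts. Qed.

Lemma cartanP s r : r \in Phi -> s \in Phi -> cartan s r * dotv r r = 2 * dotv s r.
Proof. by move=> hr hs; case: (root_facts hr) => _ _ _ /(_ s hs) [h _ _]; apply: divzK. Qed.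

Lemma cartan_bound s r : r \in Phi -> s \in Phi -> -3 <= cartan s r <= 3.
Proof.
move=> hr hs; have gt := root_gt0 hr; case: (root_facts hr) => _ _ _ /(_ s hs) [_].
by rewrite -cartanP // => h1 h2; apply/andP; split; rewrite -(ler_pM2r gt) ?mulNr.
Qed.

Lemma cartan_uniq s r x : r \in Phi -> x * dotv r r = 2 * dotv s r -> cartan s r = x.
Proof. by move=> hr e; rewrite /cartan -e mulzK // gt_eqF // root_gt0. Qed.

Lemma cartan_self r : r \in Phi -> cartan r r = 2.
Proof. by move=> hr; apply: cartan_uniq. Qed.

Lemma cartan_add s t r : r \in Phi -> s \in Phi -> t \in Phi ->
  cartan (addv s t) r = cartan s r + cartan t r.
Proof.
move=> hr hs ht; apply: cartan_uniq => //.
by rewrite mulrDl !cartanP // dotvDl ?mulrDr // !root_size.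
Qed.

Lemma cartan_opp s r : r \in Phi -> s \in Phi -> cartan (oppv s) r = - cartan s r.
Proof.
move=> hr hs; apply: cartan_uniq => //.
by rewrite mulNr cartanP // /oppv dotvZl ?root_size // mulN1r mulrN.
Qed.

Lemma cartan_oppr s r : r \in Phi -> s \in Phi -> cartan s (oppv r) = - cartan s r.
Proof.
move=> hr hs; apply: cartan_uniq; first exact: root_opp.
have [zr zs] := (root_size hr, root_size hs).
have dN t : size t = ambient X -> dotv t (oppv r) = - dotv t r.
  move=> zt; rewrite dotvC ?size_scalev ?zr //.
  by rewrite dotvZl ?zr // mulN1r dotvC ?zr ?zt.
rewrite !dN ?size_scalev // {1}/oppv dotvZl // mulN1r opprK.
by have := cartanP hr hs; lia.
Qed.

Definition strv s r (k : int) := addv s (scalev k r).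

Lemma nth_strv s r k i : size s = ambient X -> size r = ambient X ->
   nth 0 (strv s r k) i = nth 0 s i + k * nth 0 r i.
Proof. by move=> es er; rewrite nth_addv ?nth_scalev // size_scalev es er. Qed.

Lemma size_strv s r k : size s = ambient X -> size r = ambient X -> size (strv s r k) = ambient X.
Proof. by move=> es er; rewrite size_addv // size_scalev es er. Qed.

Lemma strv0 s r : size s = ambient X -> size r = ambient X -> strv s r 0 = s.
Proof. by move=> es er; apply: vec_ext => [|i]; rewrite ?size_strv // nth_strv // mul0r addr0. Qed.

Lemma strv_strv s r k l : size s = ambient X -> size r = ambient X ->
  strv (strv s r k) r l = strv s r (k + l).
Proof.
move=> es er; apply: vec_ext => [|i]; rewrite ?size_strv // !nth_strv ?size_strv //; lia.
Qed.

Lemma strv_opp s r k : size s = ambient X -> size r = ambient X ->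
  strv s (oppv r) k = strv s r (- k).
Proof.
move=> es er; have eo : size (oppv r) = ambient X by rewrite size_scalev.
apply: vec_ext => [|i]; rewrite ?size_strv // !nth_strv // nth_scalev; lia.
Qed.

Lemma cartan_strv s r k : r \in Phi -> s \in Phi -> cartan (strv s r k) r = cartan s r + 2 * k.
Proof.
move=> hr hs; apply: cartan_uniq => //.
have [zr zs] := (root_size hr, root_size hs).
rewrite dotvDl ?size_scalev ?zr ?zs // dotvZl ?zr // mulrDl cartanP //; lia.
Qed.

Lemma addv_strv r s : size s = ambient X -> size r = ambient X -> addv r s = strv s r 1.
Proof.
move=> es er; apply: vec_ext => [|i]; first by rewrite size_strv // size_addv ?es ?er.
rewrite nth_strv // nth_addv ?es ?er //; lia.
Qed.

Lemma subv_strv r s (k : int) : size s = ambient X -> size r = ambient X ->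
  subv s (scalev k r) = strv s r (- k).
Proof.
move=> es er; apply: vec_ext => [|i]; first by rewrite size_strv // size_addv ?es // !size_scalev er.
rewrite nth_strv // nth_addv ?es ?er ?nth_scalev ?nth_scalev; last by rewrite !size_scalev er.
lia.
Qed.

Lemma oppvK r : oppv (oppv r) = r.
Proof. by apply: vec_ext => [|i]; rewrite ?size_scalev // !nth_scalev; lia. Qed.

(* The only roots proportional to r are r and -r, because |<kr, r^vee>| = 2|k| <= 3. *)
Lemma strv_eq_mul s r k l : r \in Phi -> s \in Phi -> strv s r k = scalev l r ->
  s = r \/ s = oppv r.
Proof.
move=> hr hs e; have [zr zs] := (root_size hr, root_size hs).
have es : s = scalev (l - k) r.
  apply: vec_ext => [|i]; first by rewrite size_scalev zs zr.
  have : nth 0 (strv s r k) i = nth 0 (scalev l r) i by rewrite e.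
  by rewrite nth_strv // !nth_scalev mulrBl => <-; rewrite addrK.
have gt := root_gt0 hr.
have := cartan_bound hr hs; have := root_gt0 hs.
have -> : cartan s r = 2 * (l - k).
  by apply: cartan_uniq => //; rewrite {1}es dotvZl // mulrA.
have [e0|ne] := eqVneq (l - k) 0.
  by rewrite es e0 dotvZl ?size_scalev ?mul0r // ltxx.
move=> _ h; have [e1|e1] : (l - k = 1) \/ (l - k = -1) by lia.
  by left; rewrite es e1; apply: vec_ext => [|i]; rewrite ?size_scalev // nth_scalev mul1r.
by right; rewrite es e1.
Qed.

End Vectors.

(** * Root strings in the adjoint representation *)

(** Relations of the integral basis v_k = E^k/k! v_0 of the irreducible sl_2-module of dimension q +
    1, with v_0 of lowest weight. The last clause turns the first, at k = q, into [E *m v q = 0]. In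
    this basis divided powers of E and F act by binomial coefficients. *)
Definition sl2_string (R : nzRingType) d (E F : 'M[R]_d) (q : nat) (v : nat -> 'cV[R]_d) :=
  [/\ forall k, E *m v k = k.+1%:R *: v k.+1, F *m v 0 = 0,
      forall k, (k < q)%N -> F *m v k.+1 = (q - k)%:R *: v k
    & forall k, (q < k)%N -> v k = 0].

(** The vectors E^k w_0 are left undivided because this serves to find the length of a string, at a
    stage where the structure constants are only known to be nonzero. *)
Lemma sl2_lowering d (E F : 'M[int]_d) (w : nat -> 'cV[int]_d) (a : int) n :
  (forall k, E *m w k = w k.+1) -> F *m w 0 = 0 ->
  (forall k, (k <= n)%N -> E *m (F *m w k) - F *m (E *m w k) = (2 * k%:Z - a) *: w k) ->
  forall k, (k <= n)%N -> F *m w k.+1 = (k.+1%:Z * (a - k%:Z)) *: w k.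
Proof.
move=> hE hF hH; elim=> [|k IH] lk.
  have := hH 0 lk; rewrite hF mulmx0 hE sub0r => /(congr1 -%R).
  by rewrite opprK => ->; rewrite -scaleNr; congr (_ *: _); lia.
have := hH k.+1 lk; rewrite IH ?(ltnW lk) // -scalemxAr !hE => h.
have -> : F *m w k.+2 = (k.+1%:Z * (a - k%:Z)) *: w k.+1 - (2 * k.+1%:Z - a) *: w k.+1.
  by rewrite -h opprB addrC subrK.
rewrite -scalerBl; congr (_ *: _); lia.
Qed.

Lemma scale_int_inj d (a : int) : a != 0 -> injective ( *:%R a : 'cV[int]_d -> 'cV[int]_d).
Proof.
move=> ha u v /matrixP h; apply/matrixP => i j.
by have := h i j; rewrite !mxE; apply: mulfI.
Qed.

Section Adjoint.
Variables (X : ctype) (N : rootT X -> rootT X -> int) (c : rootT X -> 'I_(rank X) -> int).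
Hypothesis Hchev : is_chevalley_basis N c.
Notation Phi := (rootsys X).
Notation E r := (adM N c r).
Implicit Types (r s u : rootT X) (i : 'I_(rank X)).

Definition bv (R : nzRingType) (j : idx X) : 'cV[R]_(dimg X) := delta_mx (enum_rank j) 0.

Definition hv (R : nzRingType) r : 'cV[R]_(dimg X) := \sum_i (c r i)%:~R *: bv R (inl i).

Lemma bvE (R : nzRingType) j z o : bv R j z o = (enum_val z == j)%:R.
Proof.
rewrite !mxE (ord1 o) eqxx andbT; congr (nat_of_bool _)%:R.
by apply/eqP/eqP => [->|<-]; rewrite ?enum_rankK ?enum_valK.
Qed.

Lemma sum_bvE (R : nzRingType) (f : idx X -> R) z o :
  (\sum_k f k *: bv R k) z o = f (enum_val z).
Proof.
rewrite summxE (bigD1 (enum_val z)) //= mxE bvE eqxx mulr1 big1 ?addr0 // => k ne.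
by rewrite mxE bvE eq_sym (negbTE ne) mulr0.
Qed.

Lemma mul_bv (R : nzRingType) (M : 'M[R]_(dimg X)) j z o : (M *m bv R j) z o = M z (enum_rank j).
Proof. by rewrite (ord1 o) -colE mxE. Qed.

Lemma adM_bv r j : E r *m bv int j = \sum_(k : idx X) br N c (inr r) j k *: bv int k.
Proof. by apply/matrixP => z o; rewrite mul_bv sum_bvE mxE enum_rankK. Qed.

Lemma rootTP r : val r \in Phi. Proof. exact: ssvalP. Qed.
Hint Resolve rootTP : core.

Lemma rootT_size r : size (val r) = ambient X. Proof. exact: root_size. Qed.
Hint Resolve rootT_size : core.

Lemma val_oppR r : val (oppR r) = oppv (val r).
Proof. by rewrite /oppR val_insubd root_opp. Qed.

Lemma opp_neq r : val r != oppv (val r).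
Proof.
apply/eqP => e; have := cartan_self (rootTP r).
by rewrite {1}e (@cartan_opp X) // (@cartan_self X).
Qed.

Lemma ad_inl r i : E r *m bv int (inl i) = - cartan (val r) (simple_root i) *: bv int (inr r).
Proof.
rewrite adM_bv (bigD1 (inr r)) //= eqxx big1 ?addr0 // => k ne.
by rewrite (negbTE ne) scale0r.
Qed.

Lemma ad_opp r s : val s = oppv (val r) -> E r *m bv int (inr s) = hv int r.
Proof.
move=> e; rewrite adM_bv /= e eqxx big_sumType /= [X in _ + X]big1 => [|u _]; last by rewrite scale0r.
by rewrite addr0; apply: eq_bigr => i _; rewrite intz.
Qed.

Lemma ad_add r s u : val s != oppv (val r) -> val u = addv (val r) (val s) ->
  E r *m bv int (inr s) = N r s *: bv int (inr u).
Proof.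
move=> /negbTE e eu; rewrite adM_bv /= e -eu rootTP (bigD1 (inr u)) //= eqxx.
rewrite big1 ?addr0 // => -[i|u'] ne; rewrite ?scale0r // val_eqE.
have /negbTE-> : u' != u by [].
by rewrite scale0r.
Qed.

Lemma ad_zero r s : val s != oppv (val r) -> addv (val r) (val s) \notin Phi ->
  E r *m bv int (inr s) = 0.
Proof.
move=> /negbTE e /negbTE eu; rewrite adM_bv /= e eu.
by apply: big1 => k _; rewrite scale0r.
Qed.

Lemma c_oppR r i : c (oppR r) i = - c r i.
Proof.
case: Hchev => _ [anti _]; have := anti (inr (oppR r)) (inr r) (inl i).
by rewrite /= !val_oppR oppvK !eqxx.
Qed.

Lemma hv_oppR (R : nzRingType) r : hv R (oppR r) = - hv R r.
Proof.
by rewrite /hv -sumrN; apply: eq_bigr => i _; rewrite c_oppR mulrNz scaleNr.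
Qed.

Definition hwt r (j : idx X) : int := if j is inr s then cartan (val s) (val r) else 0.

Lemma hwt_inr r s : hwt r (inr s) = cartan (val s) (val r). Proof. by []. Qed.

(** Jacobi identity for e_r, e_{-r} and the basis vector j; the remaining term is the action of h_r,
    whose weight on e_s is sum_i c r i <s, a_i^vee> = <s, r^vee>. *)
Lemma sl2_comm r j : E r *m (E (oppR r) *m bv int j) - E (oppR r) *m (E r *m bv int j)
   = hwt r j *: bv int j.
Proof.
have mulE A B : (E A *m (E B *m bv int j)) =
    \sum_z (\sum_k br N c (inr B) j k * br N c (inr A) k z) *: bv int z.
  rewrite adM_bv mulmx_sumr; under eq_bigr do rewrite -scalemxAr adM_bv scaler_sumr.
  rewrite exchange_big; apply: eq_bigr => z _; rewrite scaler_suml.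
  by apply: eq_bigr => k _; rewrite scalerA.
rewrite !mulE -sumrB {mulE}; case: Hchev => Hc [anti [jac _]].
apply/matrixP => z o; under eq_bigr do rewrite -scalerBl.
rewrite sum_bvE mxE bvE -sumrB; set zz := enum_val z.
have := jac (inr r) (inr (oppR r)) j zz; rewrite big_split => /eqP; rewrite addr_eq0.
have -> : \sum_k br N c (inr r) (inr (oppR r)) k * br N c j k zz = - (hwt r j * (zz == j)%:R).
  rewrite big_sumType /= [X in _ + X]big1 => [|u _]; last by rewrite val_oppR eqxx mul0r.
  rewrite addr0 val_oppR eqxx; case: j => [i|s] /=.
    by rewrite big1 ?mul0r ?oppr0 // => k _; rewrite mulr0.
  have [_|_] := boolP (zz == inr s); last by rewrite mulr0 big1 ?oppr0 // => k _; rewrite mulr0.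
  by rewrite mulr1 -Hc -sumrN; apply: eq_bigr => k _; rewrite mulrN.
rewrite opprK => /eqP <-; apply: eq_bigr => k _.
by rewrite (anti j (inr r)) mulNr.
Qed.

Lemma N_neq0 r s : addv (val r) (val s) \in Phi -> N r s != 0.
Proof. by case: Hchev => _ [_ [_ [_ h]]] /h [] ->; rewrite ?oppr_eq0. Qed.

(** Where s + kr is not a root the value is the default [s], so facts about it carry a membership
    hypothesis. *)
Definition strR s r (k : int) : rootT X := insubd s (strv (val s) (val r) k).

Lemma val_strR s r k : strv (val s) (val r) k \in Phi -> val (strR s r k) = strv (val s) (val r) k.
Proof. by move=> h; rewrite val_insubd h. Qed.

Lemma addv_strR s r k : strv (val s) (val r) k \in Phi ->
  addv (val r) (val (strR s r k)) = strv (val s) (val r) (k + 1).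
Proof.
move=> h; rewrite val_strR // (@addv_strv X _ (strv (val s) (val r) k)) ?(@size_strv X) //.
by rewrite (@strv_strv X).
Qed.

Lemma strR0 s r : strR s r 0 = s.
Proof. by apply: val_inj; rewrite val_strR (@strv0 X). Qed.

Definition indep s r := (val s != val r) && (val s != oppv (val r)).

Lemma indep_oppR s r : indep s (oppR r) = indep s r.
Proof. by rewrite /indep val_oppR oppvK andbC. Qed.

Lemma indep_strR s r k : indep s r -> strv (val s) (val r) k \in Phi -> indep (strR s r k) r.
Proof.
move=> /andP[/eqP n1 /eqP n2] h; rewrite /indep val_strR //.
have bad l : strv (val s) (val r) k <> scalev l (val r).
  by move=> /(@strv_eq_mul X) [] //.
apply/andP; split; apply/eqP; last exact: bad.
move=> e; apply: (bad 1); rewrite e.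
by apply: vec_ext => [|i]; rewrite ?size_scalev // nth_scalev mul1r.
Qed.

Lemma cartan_strR s r k : strv (val s) (val r) k \in Phi ->
  cartan (val (strR s r k)) (val r) = cartan (val s) (val r) + 2 * k.
Proof. by move=> h; rewrite val_strR // (@cartan_strv X). Qed.

(** With q the last step before the string first leaves the roots, w_k = E^k e_s is a nonzero
    multiple of e_{s+kr} for k up to q, and w_{q+1} = 0. Lowering w_{q+1} gives 0 = (q+1)(a-q) w_q
    with a = -<s, r^vee>, hence a = q. *)
Lemma string_up r s : indep s r -> strv (val s) (val r) (-1) \notin Phi ->
  exists q : nat, [/\ cartan (val s) (val r) = - q%:Z,
     forall k : nat, (k <= q)%N -> strv (val s) (val r) k \in Phi &
     strv (val s) (val r) q.+1 \notin Phi].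
Proof.
move=> ind hlow; pose P (k : nat) := strv (val s) (val r) k.+1 \notin Phi.
have ex : exists k, P k.
  (* [P 3] concerns s + 4r: its pairing with r^vee would be at least -3 + 8 = 5, beyond the bound
     3. *)
  exists 3%N; apply/negP => h.
  have := cartan_bound (rootTP r) h; rewrite (@cartan_strv X) //.
  have := cartan_bound (rootTP r) (rootTP s); lia.
case: (ex_minnP ex) => q hq qmin.
have inP k : (k <= q)%N -> strv (val s) (val r) k \in Phi.
  case: k => [|k] lk; first by rewrite (@strv0 X).
  by apply: contraLR lk => /qmin; rewrite -leqNgt.
pose w k := iter k (mulmx (E r)) (bv int (inr s)).
have hw k : (k <= q)%N -> exists2 a, a != 0 & w k = a *: bv int (inr (strR s r k)).
  elim: k => [|k IH] lk; first by exists 1 => //; rewrite strR0 scale1r.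
  have [a a0 ea] := IH (ltnW lk); have hk := inP _ (ltnW lk).
  have e1 : addv (val r) (val (strR s r k)) = strv (val s) (val r) k.+1.
    by rewrite addv_strR // [_ + 1]addrC -intS.
  exists (a * N r (strR s r k)); first by rewrite mulf_neq0 // N_neq0 // e1 inP.
  rewrite /w iterS -/(w k) ea -scalemxAr (@ad_add _ _ (strR s r k.+1)) ?scalerA //.
    by have /andP[] := indep_strR ind hk.
  by rewrite e1 val_strR // inP.
have wq : w q.+1 = 0.
  have [a a0 ea] := hw _ (leqnn q); have hk := inP _ (leqnn q).
  rewrite /w iterS -/(w q) ea -scalemxAr ad_zero ?scaler0 //.
    by have /andP[] := indep_strR ind hk.
  by rewrite addv_strR // [_ + 1]addrC -intS.
have low : E (oppR r) *m w 0 = 0.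
  rewrite ad_zero // val_oppR ?oppvK; first by have /andP[] := ind.
  by rewrite (@addv_strv X) // ?size_scalev // (@strv_opp X).
have hH k : (k <= q)%N -> E r *m (E (oppR r) *m w k) - E (oppR r) *m (E r *m w k) =
    (2 * k%:Z - - cartan (val s) (val r)) *: w k.
  move=> lk; have [a a0 ea] := hw _ lk.
  rewrite ea -!scalemxAr -scalerBr sl2_comm hwt_inr cartan_strR ?inP // !scalerA; congr (_ *: _); lia.
have := sl2_lowering (fun=> erefl) low hH (leqnn q).
rewrite wq mulmx0 => /esym; have [a a0 ->] := hw _ (leqnn q).
rewrite scalerA => /matrixP/(_ (enum_rank (inr (strR s r q))) 0).
rewrite [RHS]mxE mxE bvE enum_rankK eqxx mulr1 => /eqP.
rewrite !mulf_eq0 (negbTE a0) orbF /= => /eqP h.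
exists q; split => //; lia.
Qed.

(* A gap would make the segment below it end at a root s' = s - kr with <s', r^vee> >= 0, whereas
   <s', r^vee> = <s, r^vee> - 2k < 0. *)
Lemma string_nogap r s (m : nat) : indep s r -> strv (val s) (val r) (-1) \notin Phi ->
  strv (val s) (val r) (- m.+1%:Z) \notin Phi.
Proof.
move=> ind low; have [q [eq _ _]] := string_up ind low.
elim: m => [//|m IH]; apply/negP => h.
have [||q' [e _ _]] := @string_up (oppR r) (strR s r (- m.+2%:Z)).
- by rewrite indep_oppR indep_strR.
- rewrite val_strR // val_oppR (@strv_opp X) ?(@size_strv X) // (@strv_strv X) //.
  suff -> : - m.+2%:Z + - -1 = - m.+1%:Z by [].
  by lia.
have hc := cartan_oppr (rootTP r) (rootTP (strR s r (- m.+2%:Z))).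
move: e; rewrite val_oppR hc cartan_strR // eq; lia.
Qed.

End Adjoint.

Lemma mulmx_exprS (R : pzRingType) d (M : 'M[R]_d) j (v : 'cV[R]_d) :
  M ^+ j.+1 *m v = M *m (M ^+ j *m v).
Proof. by rewrite exprS mulmxA. Qed.

Lemma sl2_string_powE d (E F : 'M[int]_d) q v j k : sl2_string E F q v ->
  E ^+ j *m v k = (j`!)%:R *: ('C(k + j, j)%:R *: v (k + j)%N).
Proof.
case=> hE _ _ _; elim: j => [|j IH]; first by rewrite expr0 mul1mx addn0 bin0 !scale1r.
rewrite mulmx_exprS IH -!scalemxAr hE addnS !scalerA -!natrM; congr (_%:R *: _).
by rewrite factS -mulnA -(mulnA j.+1) [RHS]mulnCA -mul_bin_diag /= [in RHS](mulnC _.+1).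
Qed.

Lemma sl2_string_powF d (E F : 'M[int]_d) q v j k : sl2_string E F q v -> (k <= q)%N ->
  F ^+ j *m v k = (j`!)%:R *: (if (j <= k)%N then 'C(q - k + j, j)%:R *: v (k - j)%N else 0).
Proof.
case=> _ F0 hF _ lk; elim: j => [|j IH]; first by rewrite expr0 mul1mx subn0 bin0 !scale1r.
rewrite mulmx_exprS IH -scalemxAr; case: (ltngtP j k) => [lj|lj|ej].
- rewrite -scalemxAr -(subnSK lj) hF; last by lia.
  rewrite !scalerA -!natrM; congr (_%:R *: _).
  have -> : (q - (k - j.+1))%N = (q - k + j).+1 by lia.
  rewrite addnS factS -mulnA -(mulnA j.+1) [RHS]mulnCA -mul_bin_diag /=; congr muln.
  by rewrite mulnC.
- by rewrite mulmx0 !scaler0.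
by rewrite ej subnn -scalemxAr F0 !scaler0.
Qed.

Section Strings.
Variables (X : ctype) (N : rootT X -> rootT X -> int) (c : rootT X -> 'I_(rank X) -> int).
Hypothesis Hchev : is_chevalley_basis N c.
Notation Phi := (rootsys X).
Notation E r := (adM N c r).
Notation bv := (@bv X).
Implicit Types (r s u : rootT X) (i : 'I_(rank X)).
Let rootTP := @rootTP X.
Let rootT_size := @rootT_size X.
Hint Resolve rootTP rootT_size : core.

(** [pstr] counts the roots among four vectors below s + kr. The count equals the depth in the
    string because strings have no gaps and k is at most 3. *)
Lemma pstr_string r s (k : nat) : indep s r -> strv (val s) (val r) (-1) \notin Phi ->
  (k <= 3)%N -> (forall j : nat, (j <= k)%N -> strv (val s) (val r) j \in Phi) ->
  pstr r (strR s r k) = k.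
Proof.
move=> ind low k3 inP; rewrite /pstr.
rewrite (eq_big_nat _ _ (F2 := fun j => (j <= k)%N : nat)) => [|j /andP[j0 j5]].
  by case: k k3 {inP} => [|[|[|[|k]]]] // _; rewrite unlock.
congr nat_of_bool; rewrite val_strR ?inP //.
rewrite (@subv_strv X) ?(@size_strv X) // (@strv_strv X) //.
have [ljk|lkj] := leqP j k.
  have -> : k%:Z - j%:Z = (k - j)%N by lia.
  by rewrite inP ?leq_subr.
have -> : k%:Z - j%:Z = - (j - k).-1.+1%:Z by lia.
exact/negbTE/(string_nogap Hchev).
Qed.

(** At depth k the structure constant is k+1 up to sign, so multiplying e_{s+kr} by the product of
    the signs met on the way up makes E act exactly by k+1. The coefficients of the lowering
    operator are then forced by the commutator. *)
Lemma string_normal r s : indep s r -> strv (val s) (val r) (-1) \notin Phi ->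
  exists q v, [/\ sl2_string (E r) (E (oppR r)) q v, (q <= 3)%N,
    cartan (val s) (val r) = - q%:Z &
    forall k, (k <= q)%N -> exists2 e : int, e = 1 \/ e = -1 &
      bv int (inr (strR s r k)) = e *: v k].
Proof.
move=> ind low; have [q [eq inP top]] := string_up Hchev ind low.
have q3 : (q <= 3)%N by have := cartan_bound (rootTP r) (rootTP s); rewrite eq; lia.
pose e := fix e k : int := if k is k'.+1 then e k' * sgz (N r (strR s r k')) else 1.
pose v k := if (k <= q)%N then e k *: bv int (inr (strR s r k)) else 0.
have addS k : (k <= q)%N -> addv (val r) (val (strR s r k)) = strv (val s) (val r) k.+1.
  by move=> lk; rewrite addv_strR ?inP // [_ + 1]addrC -intS.
have Nk k : (k < q)%N -> N r (strR s r k) = k.+1 \/ N r (strR s r k) = - k.+1%:Z.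
  move=> lk; case: Hchev => _ [_ [_ [_ h]]].
  have := h r (strR s r k); rewrite addS 1?ltnW // inP // => /(_ isT).
  by rewrite pstr_string //; [lia | move=> j lj; apply: inP; lia].
have e1 k : (k <= q)%N -> e k = 1 \/ e k = -1.
  elim: k => [|k IH] lk /=; first by left.
  by case: (IH (ltnW lk)) => ->; case: (Nk _ lk) => ->; rewrite ?sgzN; [left|right|right|left].
have hE k : E r *m v k = k.+1%:R *: v k.+1.
  rewrite /v; case: (ltngtP k q) => lk.
  - have ok := inP _ (ltnW lk); have /andP[_ no] := indep_strR ind ok.
    rewrite -scalemxAr (@ad_add _ _ _ _ _ (strR s r k.+1)) //; last by rewrite addS 1?ltnW // val_strR // inP.
    rewrite !scalerA /=; congr (_ *: _).
    by case: (Nk _ lk) => ->; rewrite ?sgzN /=; lia.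
  - by rewrite mulmx0 scaler0.
  rewrite -scalemxAr ad_zero ?scaler0 //.
    by have /andP[] := indep_strR ind (inP k (eq_leq lk)).
  by rewrite addS ?lk.
have hH k : (k <= q)%N -> E r *m (E (oppR r) *m v k) - E (oppR r) *m (E r *m v k) =
    (2 * k%:Z - q%:Z) *: v k.
  move=> lk; rewrite /v lk -!scalemxAr -scalerBr sl2_comm // hwt_inr cartan_strR ?inP // eq.
  by rewrite !scalerA; congr (_ *: _); lia.
have F0 : E (oppR r) *m v 0 = 0.
  rewrite /v /= strR0 scale1r ad_zero // val_oppR ?oppvK; first by have /andP[] := ind.
  by rewrite (@addv_strv X) // ?size_scalev // (@strv_opp X).
have hF k : (k < q)%N -> E (oppR r) *m v k.+1 = (q - k)%:R *: v k.
  elim: k => [|k IH] lk.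
    have := hH 0 (leq0n _); rewrite F0 mulmx0 sub0r hE scale1r => /(congr1 -%R).
    by rewrite opprK subn0 => ->; rewrite -scaleNr natz; congr (_ *: _); lia.
  have := hH k.+1 (ltnW lk); rewrite IH ?(ltnW lk) // -!scalemxAr !hE -scalemxAr => h.
  (* The commutator only determines (k+2) F v_{k+2}; the factor cancels since the vectors are
     integral. *)
  apply: (@scale_int_inj _ k.+2%:R); first by rewrite pnatr_eq0.
  have -> : k.+2%:R *: (E (oppR r) *m v k.+2) =
     (q - k)%:R *: (k.+1%:R *: v k.+1) - (2 * k.+1%:Z - q%:Z) *: v k.+1.
    by rewrite -h opprB addrC subrK.
  by rewrite !scalerA -scalerBl !natz; congr (_ *: _); lia.
exists q, v; split=> //; first by split=> // k lk; rewrite /v leqNgt lk.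
move=> k lk; exists (e k); first exact: e1.
by rewrite /v lk scalerA; case: (e1 k lk) => ->; rewrite ?mulrNN scale1r.
Qed.

(* The string e_{-r}, h_r, -e_r through the Cartan subalgebra. *)
Definition adj_string r (k : nat) : 'cV[int]_(dimg X) :=
  match k with 0 => bv int (inr (oppR r)) | 1 => hv c int r | 2 => - bv int (inr r) | _ => 0 end.

Lemma ad_hv r s : E r *m hv c int s = - cartan (val r) (val s) *: bv int (inr r).
Proof.
case: Hchev => Hc _; rewrite /hv mulmx_sumr -Hc -sumrN scaler_suml.
by apply: eq_bigr => i _; rewrite intz -scalemxAr ad_inl scalerA mulrN.
Qed.

Lemma opp_self r : cartan (oppv (val r)) (val r) = -2.
Proof. by rewrite (@cartan_opp X) // (@cartan_self X). Qed.

Lemma adj_stringP r : sl2_string (E r) (E (oppR r)) 2 (adj_string r).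
Proof.
have nil s : E s *m bv int (inr s) = 0.
  rewrite ad_zero ?opp_neq //; apply/negP; rewrite (@addv_strv X) // => h.
  by have := cartan_bound (rootTP s) h; rewrite (@cartan_strv X) // (@cartan_self X).
split => [[|[|[|k]]] | | [|[|//]] _ | [|[|[|k]]] //] /=.
- by rewrite ad_opp ?scale1r // val_oppR.
- by rewrite ad_hv (@cartan_self X) // scalerN scaleNr.
- by rewrite mulmxN nil oppr0 scaler0.
- by rewrite mulmx0 scaler0.
- exact: nil.
- by rewrite ad_hv val_oppR opp_self.
by rewrite mulmxN ad_opp ?val_oppR ?oppvK // (hv_oppR Hchev) opprK scale1r.
Qed.

(** For s = r or s = -r the string is the one through the Cartan subalgebra. Otherwise s is moved
    down by multiples of r to the last root before the first gap, where [string_normal] applies. *)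
Lemma string_through r s : exists q v k (e : int),
  [/\ sl2_string (E r) (E (oppR r)) q v, (q <= 3)%N, (k <= q)%N, (e = 1 \/ e = -1) &
     bv int (inr s) = e *: v k /\ cartan (val s) (val r) = 2 * k%:Z - q%:Z].
Proof.
have [/eqP/val_inj -> | n1] := boolP (val s == val r).
  exists 2, (adj_string r), 2, (-1); split=> //; [exact: adj_stringP | by right|].
  by split; [rewrite /= scaleN1r opprK | rewrite (@cartan_self X)].
have [/eqP e | n2] := boolP (val s == oppv (val r)).
  have -> : s = oppR r by apply: val_inj; rewrite val_oppR.
  exists 2, (adj_string r), 0, 1; split=> //; [exact: adj_stringP | by left|].
  by split; [rewrite /= scale1r | rewrite val_oppR opp_self].
have ind : indep s r by apply/andP.
have ex : exists p : nat, strv (val s) (val r) (- p.+1%:Z) \notin Phi.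
  exists 3%N; apply/negP => h.
  have := cartan_bound (rootTP r) h; rewrite (@cartan_strv X) //.
  have := cartan_bound (rootTP r) (rootTP s); lia.
case: (ex_minnP ex) => p hp pmin.
have inP k : (k <= p)%N -> strv (val s) (val r) (- k%:Z) \in Phi.
  case: k => [|k] lk; first by rewrite oppr0 (@strv0 X).
  by apply: contraLR lk => /pmin; rewrite -leqNgt.
pose s0 := strR s r (- p%:Z); have ok := inP p (leqnn _).
have back : strR s0 r p = s.
  have e : strv (val s0) (val r) p = val s.
    by rewrite val_strR // (@strv_strv X) // addNr (@strv0 X).
  by apply: val_inj; rewrite val_strR e.
have ind0 : indep s0 r by apply: indep_strR.
have low : strv (val s0) (val r) (-1) \notin Phi.
  rewrite val_strR // (@strv_strv X) //.
  by have -> : - p%:Z + -1 = - p.+1%:Z by lia.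
have [q [inQ top]] : exists q : nat, (forall k : nat, (k <= q)%N -> strv (val s0) (val r) k \in Phi) /\
     strv (val s0) (val r) q.+1 \notin Phi /\ cartan (val s0) (val r) = - q%:Z.
  by have [q [? ? ?]] := string_up Hchev ind0 low; exists q.
(* The string climbing from s0 gets back to s: it stops at s0 + (q+1)r, which is not a root, while
   s0, ..., s0 + pr = s all are. *)
have lpq : (p <= q)%N.
  rewrite leqNgt; apply/negP => lt; case: top => /negP ntop _; apply: ntop.
  rewrite val_strR // (@strv_strv X) //.
  have -> : - p%:Z + q.+1%:Z = - (p - q.+1)%N%:Z by lia.
  by apply: inP; lia.
have [q' [v [st q3 eq' hk]]] := string_normal ind0 low.
have eqq : q' = q by case: top; rewrite eq'; lia.
subst q'; have [e e1 ev] := hk p lpq.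
exists q, v, p, e; split=> //; rewrite back in ev; split=> //.
have := eq'; rewrite cartan_strR //; lia.
Qed.

(** [adDiv] divides entry by entry with a Euclidean quotient; this makes it the true divided power.
    On the column of a root vector the factorial comes from the string; on a Cartan column ad e_r
    already has square zero. *)
Lemma dvd_fact_pow r j z y : ((j`!)%:Z %| (E r ^+ j) z y)%Z.
Proof.
have -> : (E r ^+ j) z y = (E r ^+ j *m bv int (enum_val y)) z 0 by rewrite mul_bv enum_valK.
case: (enum_val y) => [i|s]; last first.
  have [q [v [k [e [st _ _ _ [-> _]]]]]] := string_through r s.
  rewrite -scalemxAr (sl2_string_powE _ _ st) mxE [_ z 0]mxE natz.
  by rewrite dvdz_mull // dvdz_mulr.
case: j => [|j]; first by rewrite dvd1z.
case: j => [|j]; first by rewrite dvd1z.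
suff -> : E r ^+ j.+2 *m bv int (inl i) = 0 by rewrite mxE dvdz0.
elim: j => [|j IH].
  rewrite mulmx_exprS expr1 ad_inl -scalemxAr.
  have [hE _ _ _] := adj_stringP r; have := hE 2; rewrite /= scaler0 mulmxN => /eqP.
  by rewrite oppr_eq0 => /eqP ->; rewrite scaler0.
by rewrite mulmx_exprS IH mulmx0.
Qed.

Lemma fact_adDiv r j : (j`!)%:Z *: adDiv N c r j = E r ^+ j.
Proof.
by apply/matrixP => z y; rewrite !mxE mulrC divzK // dvd_fact_pow.
Qed.

Lemma adDiv_mul r j (v w : 'cV[int]_(dimg X)) :
  E r ^+ j *m v = (j`!)%:R *: w -> adDiv N c r j *m v = w.
Proof.
move=> h; apply: (@scale_int_inj _ (j`!)%:Z); first by rewrite -lt0n fact_gt0.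
by rewrite scalemxAl fact_adDiv h natz.
Qed.

End Strings.

(** * Root elements and the torus *)

Section Torus.
Variables (L : fieldType) (d : nat) (U W : L -> 'M[L]_d) (q : nat) (v : nat -> 'cV[L]_d).
Hypothesis hU : forall t k, (k <= q)%N -> U t *m v k =
  v k + (t * k.+1%:R) *: v k.+1 + (t ^+ 2 * 'C(k.+2, 2)%:R) *: v k.+2
      + (t ^+ 3 * 'C(k.+3, 3)%:R) *: v k.+3.
Hypothesis hW0 : forall t, W t *m v 0 = v 0.
Hypothesis hW1 : forall t, (1 <= q)%N -> W t *m v 1 = v 1 + (t * q%:R) *: v 0.
Hypothesis hW2 : forall t, (2 <= q)%N -> W t *m v 2 =
  v 2 + (t * (q - 1)%:R) *: v 1 + (t ^+ 2 * 'C(q, 2)%:R) *: v 0.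
Hypothesis hW3 : forall t, (3 <= q)%N -> W t *m v 3 =
  v 3 + (t * (q - 2)%:R) *: v 2 + (t ^+ 2 * 'C(q - 1, 2)%:R) *: v 1
   + (t ^+ 3 * 'C(q, 3)%:R) *: v 0.
Hypothesis hv : forall k, (q < k)%N -> v k = 0.

Definition weyl t : 'M[L]_d := U t *m W (- t^-1) *m U t.

(** On the q-th symmetric power of the natural module of SL_2 the element n(t) is monomial and
    reverses the weights. For q at most 3 this is verified by expanding the three factors, with
    integral coefficients, hence in any characteristic. *)
Lemma weyl_string t k : (q <= 3)%N -> t != 0 -> (k <= q)%N ->
  weyl t *m v k = ((-1) ^+ k * t ^+ q / t ^+ (2 * k)) *: v (q - k)%N.
Proof.
move=> q3 t0; rewrite /weyl -!mulmxA.
have b : ('C(2, 2) = 1)%N * ('C(3, 2) = 3)%N * ('C(4, 2) = 6)%N * ('C(5, 2) = 10)%N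
   * ('C(3, 3) = 1)%N * ('C(4, 3) = 4)%N * ('C(5, 3) = 10)%N * ('C(6, 3) = 20)%N
   * (2 * 0 = 0)%N * (2 * 1 = 2)%N * (2 * 2 = 4)%N * (2 * 3 = 6)%N by [].
case: q q3 hU hW1 hW2 hW3 hv => [|[|[|[|//]]]] _ kU kW1 kW2 kW3 kv;
  have [z3 z4 z5 z6] : [/\ v 4 = 0, v 5 = 0, v 6 = 0 & v 7 = 0] by split; apply: kv.
- have [z1 z2 z7] : [/\ v 1 = 0, v 2 = 0 & v 3 = 0] by split; apply: kv.
  case: k => [|//] _; do 4!rewrite ?mulmxDr -?scalemxAr ?kU ?hW0 // ?z1 ?z2 ?z7 ?scaler0 ?addr0.
  by rewrite !expr0 mul1r divr1 scale1r.
- have [z1 z2] : [/\ v 2 = 0 & v 3 = 0] by split; apply: kv.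
  by case: k => [|[|//]] _;
   do 4!rewrite ?mulmxDr -?scalemxAr ?kU ?hW0 ?kW1 // ?z1 ?z2 ?z3 ?scaler0 ?addr0 ?b /=;
   rewrite ?subSS ?subn0 ?b; apply/matrixP => i o; rewrite !mxE; field; rewrite ?oner_eq0 ?t0.
- have z1 : v 3 = 0 by apply: kv.
  by case: k => [|[|[|//]]] _;
   do 4!rewrite ?mulmxDr -?scalemxAr ?kU ?hW0 ?kW1 ?kW2 // ?z1 ?z3 ?z4 ?scaler0 ?addr0 ?b /=;
   rewrite ?subSS ?subn0 ?b; apply/matrixP => i o; rewrite !mxE; field; rewrite ?oner_eq0 ?t0.
by case: k => [|[|[|[|//]]]] _;
   do 4!rewrite ?mulmxDr -?scalemxAr ?kU ?hW0 ?kW1 ?kW2 ?kW3 // ?z3 ?z4 ?z5 ?scaler0 ?addr0 ?b /=;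
   rewrite ?subSS ?subn0 ?b; apply/matrixP => i o; rewrite !mxE; field; rewrite ?oner_eq0 ?t0.
Qed.

Lemma torus_string t k : (q <= 3)%N -> t != 0 -> (k <= q)%N ->
  weyl t *m (weyl (-1) *m v k) = t ^ (2 * k%:Z - q%:Z) *: v k.
Proof.
move=> q3 t0 kq; rewrite weyl_string ?oppr_eq0 ?oner_eq0 // -scalemxAr.
rewrite weyl_string ?leq_subr // subKn // scalerA; congr (_ *: _).
have -> : t ^ (2 * k%:Z - q%:Z) = t ^+ q / t ^+ (2 * (q - k)).
  have -> : 2 * k%:Z - q%:Z = q%:Z - (2 * (q - k))%N%:Z by lia.
  by rewrite expfzDr // -exprnN.
(* The two reversals contribute the sign exponents k + q and q - k, of even sum 2q. *)
have s2 n : (-1 : L) ^+ (2 * n) = 1 by rewrite exprM sqrrN !expr1n.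
rewrite s2 divr1 !mulrA -!exprD -signr_odd.
have -> : odd (k + q + (q - k)) = false by lia.
by rewrite mul1r.
Qed.

End Torus.

Lemma simple_root_in X (i : 'I_(rank X)) : simple_root i \in rootsys X.
Proof.
have sub n (j : nat) : (j.+1 < n)%N -> subv (ev n j) (ev n j.+1) \in dd n.
  by move=> lj; rewrite subv_ev //; apply/mem_dd; exists j, j.+1, 1, (-1).
have last_ax n a : (0 < n)%N -> a = 1 \/ a = 2 -> scalev a (ev n n.-1) \in axial n a.
  by move=> n0 _; apply/mem_axial; exists n.-1, 1; split=> //; rewrite ?mul1r // prednK.
rewrite /simple_root; case: X i => [n|n||] i.
- rewrite nth_cat size_map size_iota; case: ltnP => li.
    rewrite (nth_map 0) ?size_iota // nth_iota // add0n mem_cat sub ?orbT //; lia.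
  have -> : (i - n.-1)%N = 0 by have := ltn_ord i; rewrite /=; lia.
  rewrite mem_cat /= -(scale1v (ev n n.-1)) last_ax //; [by have := ltn_ord i; rewrite /=; lia | by left].
- rewrite nth_cat size_map size_iota; case: ltnP => li.
    rewrite (nth_map 0) ?size_iota // nth_iota // add0n mem_cat sub ?orbT //; lia.
  have -> : (i - n.-1)%N = 0 by have := ltn_ord i; rewrite /=; lia.
  rewrite mem_cat /= last_ax //; [by have := ltn_ord i; rewrite /=; lia | by right].
- by case: i => -[|[|[|[|//]]]] ?; vm_compute.
by case: i => -[|[|//]] ?; vm_compute.
Qed.

Section RootElements.
Variables (X : ctype) (N : rootT X -> rootT X -> int) (c : rootT X -> 'I_(rank X) -> int).
Hypothesis HX : valid_type X.
Hypothesis Hchev : is_chevalley_basis N c.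
Variable L : fieldType.
Notation E r := (adM N c r).
Notation bv := (@bv X).
Notation toL := (map_mx (fun z : int => z%:~R : L)).
Implicit Types (r s : rootT X) (i : 'I_(rank X)) (t : L).
Let rootTP := @rootTP X.
Hint Resolve rootTP : core.

(** [ur] cuts the exponential at [dimg X] terms; strings of length 4 require those of exponents 0 to
    3. *)
Lemma dimg_ge4 r : (4 <= dimg X)%N.
Proof.
rewrite /dimg card_sum card_ord.
have hr : (2 <= rank X)%N by case: (X) HX.
have : (2 <= #|{: rootT X}|)%N.
  rewrite -(_ : #|[set r; oppR r]| = 2%N); first by rewrite max_card.
  rewrite cards2; case: eqP => // e; have := opp_neq r.
  by rewrite -val_oppR -e eqxx.
by move=> h; apply: (leq_add hr h).
Qed.

Lemma toL_mul (m n p : nat) (A : 'M[int]_(m, n)) (B : 'M[int]_(n, p)) :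
  toL (A *m B) = toL A *m toL B.
Proof. exact: (@map_mxM _ _ (intmul (1 : L))). Qed.

Lemma toL_scale m n (a : int) (A : 'M[int]_(m, n)) : toL (a *: A) = (a%:~R : L) *: toL A.
Proof. by apply/matrixP => i j; rewrite !mxE intrM. Qed.

Lemma toL_opp m n (A : 'M[int]_(m, n)) : toL (- A) = - toL A.
Proof. by apply/matrixP => i j; rewrite !mxE mulrNz. Qed.

Lemma toL0 m n : toL (0 : 'M[int]_(m, n)) = 0.
Proof. by apply/matrixP => i j; rewrite !mxE. Qed.

Lemma toL_bv j : toL (bv int j) = bv L j.
Proof. by apply/matrixP => i o; rewrite !mxE; case: (_ && _). Qed.

Lemma toL_hv r : toL (hv c int r) = hv c L r.
Proof.
apply/matrixP => z o; rewrite mxE !summxE; rewrite (@rmorph_sum _ _ (intmul (1 : L))) /=.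
apply: eq_bigr => i _; rewrite !mxE !intz intrM; congr (_ * _).
by case: (_ && _).
Qed.

Lemma ur_mul r t (v : 'cV[int]_(dimg X)) (w : nat -> 'cV[int]_(dimg X)) :
  (forall j, E r ^+ j *m v = (j`!)%:R *: w j) -> (forall j, (3 < j)%N -> w j = 0) ->
  ur N c r t *m toL v = toL (w 0) + t *: toL (w 1) + t ^+ 2 *: toL (w 2) + t ^+ 3 *: toL (w 3).
Proof.
move=> h hw; rewrite /ur mulmx_suml.
under eq_bigr do rewrite -scalemxAl -toL_mul (adDiv_mul Hchev (h _)).
have -> : \sum_(k < dimg X) t ^+ k *: toL (w k) = \sum_(0 <= k < dimg X) t ^+ k *: toL (w k).
  by rewrite big_mkord.
rewrite (@big_cat_nat _ _ _ 4) ?(dimg_ge4 r) //= [X in _ + X]big_nat_cond [X in _ + X]big1 ?addr0.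
  by rewrite unlock /= expr0 expr1 scale1r addr0 !addrA.
by move=> k /andP[/andP[k4 _] _]; rewrite hw // -[0 : 'cV[int]_ _](scale0r 0) toL_scale scale0r scaler0.
Qed.

Section String.
Variables (r : rootT X) (q : nat) (v : nat -> 'cV[int]_(dimg X)).
Hypotheses (st : sl2_string (E r) (E (oppR r)) q v) (q3 : (q <= 3)%N).

Lemma ur_stringE t k : ur N c r t *m toL (v k) =
  toL (v k) + (t * k.+1%:R) *: toL (v k.+1) + (t ^+ 2 * 'C(k.+2, 2)%:R) *: toL (v k.+2)
      + (t ^+ 3 * 'C(k.+3, 3)%:R) *: toL (v k.+3).
Proof.
have vz : forall k, (q < k)%N -> v k = 0 by case: st.
rewrite (@ur_mul _ _ _ (fun j => 'C(k + j, j)%:R *: v (k + j)%N)).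
- by rewrite !natz !toL_scale !addnS addn0 bin0 bin1 scale1r !scalerA.
- by move=> j; apply: (sl2_string_powE _ _ st).
by move=> j j3; rewrite vz ?scaler0 //; lia.
Qed.

Lemma ur_stringF t k : (k <= q)%N -> ur N c (oppR r) t *m toL (v k) =
  toL (v k) + (t * (if (1 <= k)%N then (q - k).+1%:R else 0)) *: toL (v (k - 1)%N)
   + (t ^+ 2 * (if (2 <= k)%N then 'C((q - k).+2, 2)%:R else 0)) *: toL (v (k - 2)%N)
   + (t ^+ 3 * (if (3 <= k)%N then 'C((q - k).+3, 3)%:R else 0)) *: toL (v (k - 3)%N).
Proof.
move=> kq; rewrite (@ur_mul _ _ _ (fun j => if (j <= k)%N then 'C(q - k + j, j)%:R *: v (k - j)%N else 0)).
- rewrite !natz !addnS addn0 bin0 bin1 scale1r subn0.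
  by do ![case: ifP => _]; rewrite ?mulr0 ?toL0 ?toL_scale ?scale0r ?scaler0 ?scalerA.
- by move=> j; apply: (sl2_string_powF _ st).
by move=> j j3; case: ifP => //; lia.
Qed.

Lemma nr_weyl t : nr N c r t = weyl (ur N c r) (ur N c (oppR r)) t.
Proof. by []. Qed.

Lemma hr_string t k : t != 0 -> (k <= q)%N ->
  hr N c r t *m toL (v k) = t ^ (2 * k%:Z - q%:Z) *: toL (v k).
Proof.
move=> t0 kq; rewrite /hr !nr_weyl -mulmxA.
have vz : forall k, (q < k)%N -> v k = 0 by case: st.
apply: (@torus_string _ _ _ _ q (fun k => toL (v k))) => //.
- by move=> t' k' _; apply: ur_stringE.
- by move=> t'; rewrite ur_stringF //= !mulr0 !scale0r !addr0.
- by move=> t' q1; rewrite ur_stringF //= !mulr0 !scale0r !addr0 -subSn // subSS subn0.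
- by move=> t' q1; rewrite ur_stringF //= !mulr0 !scale0r !addr0 -!subSn ?subSS ?subn0 //; lia.
- by move=> t' q1; rewrite ur_stringF //= -!subSn ?subSS ?subn0 //; lia.
by move=> k' hk'; rewrite vz ?toL0.
Qed.

End String.

Lemma hr_inr r s t : t != 0 -> hr N c r t *m bv L (inr s) = t ^ cartan (val s) (val r) *: bv L (inr s).
Proof.
move=> t0; have [q [v [k [e [st q3 kq _ [es ->]]]]]] := string_through Hchev r s.
by rewrite -toL_bv es toL_scale -scalemxAr (hr_string st) // !scalerA mulrC.
Qed.

Lemma ur_inl r t i : ur N c r t *m bv L (inl i) =
  bv L (inl i) - (t * (cartan (val r) (simple_root i))%:~R) *: bv L (inr r).
Proof.
pose w j := match j with
  | 0 => bv int (inl i)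
  | 1 => - cartan (val r) (simple_root i) *: bv int (inr r)
  | _ => 0 end.
rewrite -toL_bv (@ur_mul _ _ _ w) => [|j|[|[|]] //].
  by rewrite /w !toL0 !scaler0 !addr0 toL_scale !toL_bv scalerA mulrNz mulrN scaleNr.
case: j => [|[|j]]; first by rewrite expr0 mul1mx scale1r.
  by rewrite expr1 scale1r ad_inl.
rewrite scaler0; elim: j => [|j IH]; last by rewrite mulmx_exprS IH mulmx0.
rewrite mulmx_exprS expr1 ad_inl -scalemxAr.
have [hE _ _ _] := adj_stringP Hchev r; have := hE 2; rewrite /= scaler0 mulmxN => /eqP.
by rewrite oppr_eq0 => /eqP ->; rewrite scaler0.
Qed.

Lemma ur_opp r t : ur N c r t *m bv L (inr (oppR r)) =
  bv L (inr (oppR r)) + t *: hv c L r - t ^+ 2 *: bv L (inr r).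
Proof.
have := ur_stringE (adj_stringP Hchev r) isT t 0.
rewrite /= (_ : 'C(2, 2) = 1)%N // !toL0 !scaler0 !addr0 !mulr1 toL_bv toL_hv => ->.
by rewrite toL_opp toL_bv scalerN.
Qed.

(** A single h_i need not lie in a string, but u_r and u_{-r} move it by multiples of v_2 and v_0 of
    the string through h_r. The outcome is the reflection in r, independent of t, so h_r(t) = n_r(t)
    n_r(-1) acts on the Cartan part as the square of a reflection, trivially. *)
Lemma nr_inl r t i : t != 0 -> nr N c r t *m bv L (inl i) =
  bv L (inl i) - (cartan (val r) (simple_root i))%:~R *: hv c L r.
Proof.
move=> t0; set a := (cartan _ _)%:~R; set h := bv L (inl i).
pose v k := toL (adj_string c r k).
have Uh x : ur N c r x *m h = h + (x * a) *: v 2.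
  by rewrite ur_inl /v /= toL_opp toL_bv -/a -/h scalerN.
have Wh x : ur N c (oppR r) x *m h = h + (x * a) *: v 0.
  by rewrite ur_inl /v /= toL_bv val_oppR (@cartan_opp X) ?simple_root_in // mulrNz mulrN scaleNr opprK.
have U1 x : ur N c r x *m v 1 = v 1 + (2 * x) *: v 2.
  rewrite (ur_stringE (adj_stringP Hchev r) isT) /v /= !toL0 !scaler0 !addr0.
  by rewrite mulrC.
have U2 x : ur N c r x *m v 2 = v 2.
  by rewrite (ur_stringE (adj_stringP Hchev r) isT) /v /= !toL0 !scaler0 !addr0.
have U0 x : ur N c r x *m v 0 = v 0 + x *: v 1 + x ^+ 2 *: v 2.
  rewrite (ur_stringE (adj_stringP Hchev r) isT) /v /= !toL0 !scaler0 !addr0.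
  by rewrite (_ : 'C(2, 2) = 1)%N // !mulr1.
have W2 x : ur N c (oppR r) x *m v 2 = v 2 + x *: v 1 + x ^+ 2 *: v 0.
  rewrite (ur_stringF (adj_stringP Hchev r) isT) //= !mulr0 !scale0r !addr0.
  by rewrite (_ : 'C(2, 2) = 1)%N // !mulr1.
rewrite (_ : hv c L r = v 1); last by rewrite /v /= toL_hv.
rewrite /nr -!mulmxA Uh !mulmxDr -!scalemxAr Wh W2 !mulmxDr -!scalemxAr Uh U2 U1 U0.
by apply/matrixP => z o; rewrite !mxE; field.
Qed.

Lemma nr_hv r t : t != 0 -> nr N c r t *m hv c L r = - hv c L r.
Proof.
move=> t0; rewrite {1}/hv mulmx_sumr.
under eq_bigr do rewrite -scalemxAr nr_inl // scalerBr scalerA -intrM.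
rewrite sumrB -scaler_suml -(@rmorph_sum _ _ (intmul (1 : L))) /=; case: Hchev => Hc _.
rewrite Hc (@cartan_self X) // -/(hv c L r) (_ : 2%:~R = 1 + 1 :> L) // scalerDl scale1r opprD addrA subrr.
by rewrite add0r.
Qed.

Lemma hr_inl r t i : t != 0 -> hr N c r t *m bv L (inl i) = bv L (inl i).
Proof.
move=> t0; rewrite /hr -mulmxA nr_inl ?oppr_eq0 ?oner_eq0 // mulmxBr nr_inl //.
by rewrite -scalemxAr nr_hv // scalerN opprK subrK.
Qed.

Definition torus (f : rootT X -> L) : 'M[L]_(dimg X) :=
  diag_mx (\row_z (if enum_val z is inr s then f s else 1)).

Lemma eq_mulmx_bv (A B : 'M[L]_(dimg X)) : (forall j, A *m bv L j = B *m bv L j) -> A = B.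
Proof.
move=> h; apply/matrixP => z y.
by have := congr1 (fun M : 'cV_ _ => M z 0) (h (enum_val y)); rewrite !mul_bv enum_valK.
Qed.

Lemma torus_bv f j : torus f *m bv L j = (if j is inr s then f s else 1) *: bv L j.
Proof.
rewrite /torus mul_diag_mx; apply/matrixP => z o; rewrite mxE !mxE.
by have [->|ne] := eqVneq z (enum_rank j); rewrite ?enum_rankK // !mulr0.
Qed.

Lemma hrE r t : t != 0 -> hr N c r t = torus (fun s => t ^ cartan (val s) (val r)).
Proof.
move=> t0; apply: eq_mulmx_bv => -[i|s]; rewrite torus_bv ?scale1r ?hr_inl // hr_inr //.
Qed.

Lemma torusM f g : torus f *m torus g = torus (fun s => f s * g s).
Proof.
rewrite /torus mulmx_diag; congr diag_mx; apply/rowP => z; rewrite !mxE.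
by case: (enum_val z) => [_|s] //; rewrite mulr1.
Qed.

Lemma eq_torus f g : f =1 g -> torus f = torus g.
Proof. by move=> e; congr diag_mx; apply/rowP => z; rewrite !mxE; case: (enum_val z). Qed.

Lemma torus1 : torus (fun=> 1) = 1%:M.
Proof. by apply: eq_mulmx_bv => j; rewrite torus_bv mul1mx; case: j => *; rewrite scale1r. Qed.

Lemma torus_inv f : (forall s, f s != 0) -> invmx (torus f) = torus (fun s => (f s)^-1).
Proof.
move=> f0; have e : torus f *m torus (fun s => (f s)^-1) = 1%:M.
  by rewrite torusM -torus1; apply: eq_torus => s; rewrite mulfV.
have u := (mulmx1_unit e).1.
by rewrite -[RHS]mul1mx -(mulVmx u) -mulmxA e mulmx1.
Qed.

Lemma torus_inj f g : torus f = torus g -> f =1 g.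
Proof.
move=> e s; have := congr1 (fun M => (M *m bv L (inr s)) (enum_rank (inr s)) 0) e.
by rewrite !torus_bv !mxE !eqxx !mulr1.
Qed.

(** A character of the root lattice seen through its values on roots. The second clause covers the
    case of sum zero, where the bracket of two root vectors falls into the Cartan subalgebra. *)
Definition root_char (f : rootT X -> L) :=
  [/\ forall s, f s != 0, forall s, f (oppR s) = (f s)^-1 &
     forall r s u, val u = addv (val r) (val s) -> f u = f r * f s].

(** ad e_r is homogeneous of degree r for the grading by the root lattice, so conjugation multiplies
    every nonzero entry of its k-th power by (f r)^k, which amounts to replacing t by f r * t. *)
Lemma torus_conj f r t : root_char f ->
  torus f *m ur N c r t *m invmx (torus f) = ur N c r (f r * t).
Proof.
move=> [f0 fN fD]; rewrite torus_inv //.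
pose g (j : idx X) := if j is inr s then f s else 1.
have g0 j : g j != 0 by case: j => [_|s] //=; rewrite oner_eq0.
have br_gr j k : br N c (inr r) j k != 0 -> g k = f r * g j.
  case: j => [i|s] /=; first by case: (k =P inr r) => [->|_]; rewrite ?eqxx //= mulr1.
  case: (ssval s =P _) => [e|ne].
    case: k => [i _|//] /=.
    have -> : s = oppR r by apply: val_inj; rewrite val_oppR.
    by rewrite fN mulfV.
  case: ifP => // _; case: k => [|u]; rewrite ?eqxx //.
  case: (ssval u =P _) => [e _|_]; rewrite ?eqxx //; exact: fD.
have pow_gr j z y : (E r ^+ j) z y != 0 -> g (enum_val z) = f r ^+ j * g (enum_val y).
  elim: j z y => [|j IH] z y.
    by rewrite expr0 mxE; case: (z =P y) => [->|_]; rewrite ?mul1r // eqxx.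
  rewrite exprS mxE => h; have [k hk] : exists k, E r z k * (E r ^+ j) k y != 0.
    apply/existsP; apply: contraNT h; rewrite negb_exists => /forallP h.
    by apply/eqP; apply: big1 => k _; apply/eqP; have := h k; rewrite negbK.
  move: hk; rewrite mulf_eq0 negb_or => /andP[h1 /IH h2].
  by rewrite exprS -mulrA -h2; apply: br_gr; move: h1; rewrite mxE.
apply/matrixP => z y; rewrite /torus mul_mx_diag mul_diag_mx !mxE /ur !summxE.
rewrite mulr_sumr mulr_suml; apply: eq_bigr => k _; rewrite !mxE exprMn.
(* A zero entry of the power stays zero after the Euclidean division by k!. *)
have [e|ne] := eqVneq ((E r ^+ k) z y) 0; first by rewrite e div0z mulr0z !mulr0 mul0r.
have := pow_gr _ _ _ ne; rewrite /g => ->.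
have gy := g0 (enum_val y); rewrite /g in gy.
have -> : (match enum_val y with inl _ => 1 | inr s => (f s)^-1 end) =
   (match enum_val y with inl _ => 1 | inr s => f s end)^-1.
  by case: (enum_val y) => [_|//]; rewrite invr1.
by rewrite mulrAC mulfK // mulrA.
Qed.

Lemma ur_coef r t : ur N c r t (enum_rank (inr r)) (enum_rank (inr (oppR r))) = - t ^+ 2.
Proof.
rewrite -(mul_bv _ _ _ 0) ur_opp !mxE !summxE big1 => [|i _].
  rewrite !eqxx andbT !(inj_eq enum_rank_inj) mulr0 addr0 mulr1.
  have /negbTE -> : inr r != inr (oppR r) :> idx X.
    by apply/eqP => -[] e; have := opp_neq r; rewrite -val_oppR -e eqxx.
  by rewrite sub0r.
by rewrite !mxE (inj_eq enum_rank_inj) mulr0.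
Qed.

End RootElements.

(** * The groups T(K,L) and X(K,L) *)

Section Groups.
Variables (X : ctype) (N : rootT X -> rootT X -> int) (c : rootT X -> 'I_(rank X) -> int).
Hypothesis HX : valid_type X.
Hypothesis Hchev : is_chevalley_basis N c.
Variables (L : fieldType) (K : divringClosed L).
Hypothesis Hfrob : forall x : L, x ^+ char_of X \in K.
Implicit Types (r s : rootT X) (i : 'I_(rank X)) (t : L) (f : rootT X -> L).
Let rootTP := @rootTP X.
Hint Resolve rootTP : core.

Lemma gengrp_sub d (S S' : 'M[L]_d -> Prop) : (forall g, S g -> gengrp S' g) ->
  forall g, gengrp S g -> gengrp S' g.
Proof.
move=> h g; elim=> [|{}g /h //|{}g g' _ h1 _ h2|{}g _ h1].
- exact: gen_one.
- exact: gen_mul.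
exact: gen_inv.
Qed.

Lemma exprz_in t (z : int) : t \in K -> t ^ z \in K.
Proof. by move=> tK; case: z => n; rewrite ?NegzE -?exprnN ?rpredV rpredX. Qed.

Lemma exprz_char_in t (z : int) : ((char_of X)%:Z %| z)%Z -> t ^ z \in K.
Proof.
case/dvdzP=> m ->; rewrite mulrC -exprz_exp; apply: exprz_in; exact: Hfrob.
Qed.

Lemma root_char_exp r t : t != 0 -> root_char (fun s => t ^ cartan (val s) (val r)).
Proof.
move=> t0; split=> [s|s|s u w e]; first exact: expfz_neq0.
  by rewrite val_oppR (@cartan_opp X) // invr_expz.
by rewrite e (@cartan_add X) // expfzDr.
Qed.

Lemma root_char1 : root_char (fun _ : rootT X => 1 : L).
Proof. by split=> *; rewrite ?oner_eq0 ?invr1 ?mulr1. Qed.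

Lemma root_charM f g : root_char f -> root_char g -> root_char (fun s => f s * g s).
Proof.
move=> [f0 fN fD] [g0 gN gD]; split=> [s|s|s u w e]; first by rewrite mulf_neq0.
  by rewrite fN gN invfM.
by rewrite (fD _ _ _ e) (gD _ _ _ e) mulrACA.
Qed.

Lemma root_charV f : root_char f -> root_char (fun s => (f s)^-1).
Proof.
move=> [f0 fN fD]; split=> [s|s|s u w e]; first by rewrite invr_eq0.
  by rewrite fN.
by rewrite (fD _ _ _ e) invfM.
Qed.

Definition torus_in (P : (rootT X -> L) -> Prop) (h : 'M[L]_(dimg X)) :=
  exists f, [/\ h = torus f, root_char f & P f].

(** Turns a multiplicative invariant of characters, checked on generators, into an invariant of the
    group of matrices; the separations in types B and C rest on it. *)
Lemma gengrp_torus (S : 'M[L]_(dimg X) -> Prop) P :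
  (forall g, S g -> torus_in P g) -> P (fun=> 1) ->
  (forall f g, root_char f -> root_char g -> P f -> P g -> P (fun s => f s * g s)) ->
  (forall f, root_char f -> P f -> P (fun s => (f s)^-1)) ->
  forall h, gengrp S h -> torus_in P h.
Proof.
move=> hS h1 hM hV h; elim=> [|g /hS //|g g' _ [f [-> cf Pf]] _ [f' [-> cf' Pf']]|g _ [f [-> cf Pf]]].
- by exists (fun=> 1); rewrite torus1; split=> //; exact: root_char1.
- by exists (fun s => f s * f' s); rewrite torusM; split=> //; [exact: root_charM | exact: hM].
exists (fun s => (f s)^-1); rewrite torus_inv; last by case: cf.
by split=> //; [exact: root_charV | exact: hV].
Qed.

Lemma torus_gen_in (P : (rootT X -> L) -> Prop) r t : t != 0 -> P (fun s => t ^ cartan (val s) (val r)) ->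
  torus_in P (hr N c r t).
Proof.
move=> t0 Pf; exists (fun s => t ^ cartan (val s) (val r)).
by rewrite (hrE HX Hchev) //; split=> //; exact: root_char_exp.
Qed.

Definition simpleR i : rootT X := SeqSub (simple_root_in i).

Definition simple_char (t : 'I_(rank X) -> L) (s : rootT X) : L :=
  \prod_i t i ^ cartan (val s) (simple_root i).

Lemma TL_simple h : TL N c h -> exists t : 'I_(rank X) -> L,
  (forall i, t i != 0) /\ h = torus (simple_char t).
Proof.
move=> hT; suff [f [-> _ [t [t0 et]]]] :
    torus_in (fun f => exists t : 'I_(rank X) -> L, (forall i, t i != 0) /\ f =1 simple_char t) h.
  by exists t; split=> //; apply: eq_torus.
apply: gengrp_torus hT => [g [r [x [x0 ->]]]||f g _ _ [t [t0 et]] [u [u0 eu]]|f _ [t [t0 et]]].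
(* From r^vee = sum_i c r i a_i^vee, the element h_r(x) is the product of the h_{a_i}(x^(c r i)). *)
- apply: torus_gen_in => //; exists (fun i => x ^ c r i); split=> [i|s]; first exact: expfz_neq0.
  case: Hchev => Hc _; rewrite -Hc /simple_char.
  rewrite (big_morph _ (fun a b => expfzDr a b x0) (expr0z x)).
  by apply: eq_bigr => i _; rewrite exprz_exp.
- exists (fun=> 1); split=> [i|s]; first exact: oner_neq0.
  by rewrite /simple_char big1 // => i _; rewrite exp1rz.
- exists (fun i => t i * u i); split=> [i|s]; first by rewrite mulf_neq0.
  by rewrite et eu /simple_char -big_split; apply: eq_bigr => i _; rewrite expfzMl.
exists (fun i => (t i)^-1); split=> [i|s]; first by rewrite invr_eq0.
by rewrite et /simple_char -prodfV; apply: eq_bigr => i _; rewrite exprz_inv invr_expz.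
Qed.

Lemma simple_char_gen (S : 'M[L]_(dimg X) -> Prop) (t : 'I_(rank X) -> L) :
  (forall i, t i != 0) -> (forall i, gengrp S (hr N c (simpleR i) (t i))) ->
  gengrp S (torus (simple_char t)).
Proof.
move=> t0 h; rewrite /simple_char; elim: (index_enum _) => [|i l IH].
  rewrite (_ : torus _ = 1%:M); first exact: gen_one.
  by rewrite -torus1; apply: eq_torus => s; rewrite big_nil.
have := gen_mul (h i) IH; rewrite (hrE HX Hchev) // torusM.
by rewrite (@eq_torus _ _ _ (fun s => \prod_(j <- i :: l) t j ^ cartan (val s) (simple_root j))) // => s;
  rewrite big_cons.
Qed.

Lemma TL_char h : TL N c h -> torus_in (fun=> True) h.
Proof.
by apply: gengrp_torus => // g [r [x [x0 ->]]]; apply: torus_gen_in.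
Qed.

(* The only matrix entry needed to read off f r is -t^2 at (e_r, e_{-r}); it determines f r up to
   sign, which suffices since K is closed under negation. *)
Lemma TKL_long f : TKL N c K (torus f) -> root_char f -> forall r, is_long r -> f r \in K.
Proof.
move=> [_ h] cf r lr; have [a aK /(_ 1)] := h r lr.
rewrite torus_conj // !mulr1.
move/(congr1 (fun M : 'M_ _ => M (enum_rank (inr r)) (enum_rank (inr (oppR r))))).
rewrite !(ur_coef HX Hchev) => /oppr_inj/eqP; rewrite eqf_sqr => /orP[] /eqP -> //.
by rewrite rpredN.
Qed.

Lemma long_TKL f : TL N c (torus f) -> root_char f -> (forall r, is_long r -> f r \in K) ->
  TKL N c K (torus f).
Proof.
move=> hT cf h; split=> // r lr; exists (f r); first exact: h.
by move=> t; rewrite torus_conj.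
Qed.

Lemma Tgen_TL h : Tgen N c K h -> TL N c h.
Proof.
apply: gengrp_sub => g [r [t [t0 [_ ->]]]]; apply: gen_in; by exists r, t.
Qed.

Lemma Tgen_TKL : (forall r s, is_long r -> ~~ is_long s ->
    ((char_of X)%:Z %| cartan (val r) (val s))%Z) ->
  forall h, Tgen N c K h -> TKL N c K h.
Proof.
move=> D h hT; have hL := Tgen_TL hT.
suff [f [e cf Pf]] : torus_in (fun f => forall r, is_long r -> f r \in K) h.
  by rewrite e in hL *; apply: long_TKL.
apply: gengrp_torus hT => [g [s [t [t0 [/implyP tK ->]]]]|r _|f g _ _ hf hg r lr|f _ hf r lr].
- apply: torus_gen_in => // r lr; have [ls|ss] := boolP (is_long s).
    by apply: exprz_in; apply: tK.
  by apply: exprz_char_in; apply: D.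
- exact: rpred1.
- by rewrite rpredM ?hf ?hg.
by rewrite rpredV hf.
Qed.

Lemma TKL_Tgen : (forall t : 'I_(rank X) -> L, (forall i, t i != 0) ->
     (forall r, is_long r -> simple_char t r \in K) ->
     forall i, is_long (simpleR i) -> t i \in K) ->
  forall h, TKL N c K h -> Tgen N c K h.
Proof.
move=> S h hT; have [t [t0 e]] := TL_simple hT.1.
have [f [ef cf _]] := TL_char hT.1.
have fe : f =1 simple_char t by apply: torus_inj; rewrite -ef.
have tK := S t t0; rewrite ef in hT; have lK := TKL_long hT cf.
rewrite e; apply: simple_char_gen => // i; apply: gen_in; exists (simpleR i), (t i).
split=> //; split=> //; apply/implyP; apply: tK => r lr.
by rewrite -fe; apply: lK.
Qed.

Lemma is_longP r : reflect (forall v, v \in rootsys X -> dotv v v <= dotv (val r) (val r)) (is_long r).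
Proof.
apply: (iffP forallP) => [h s hs|h s]; first exact: (h (SeqSub hs)).
by apply: h.
Qed.

Lemma is_long_oppR r : is_long (oppR r) = is_long r.
Proof.
rewrite /is_long; apply: eq_forallb => s; congr (_ <= _); rewrite val_oppR.
have z := root_size (rootTP r).
by rewrite /oppv dotvZl ?size_scalev // dotvC ?size_scalev // dotvZl // !mulN1r opprK.
Qed.

(** h_r(t) is a word in u_r and u_{-r} with parameters among t, -t^{-1}, 1, -1. Since r and -r have
    equal length, t in K keeps all of these admissible when r is long. *)
Lemma XKL_Ugen : (forall h, TKL N c K h -> Tgen N c K h) ->
  forall g, XKL N c K g <-> Ugen N c K g.
Proof.
move=> h g; split; apply: gengrp_sub => {}g; last by move=> hg; apply: gen_in; right.
case=> [/h|hg]; last exact: gen_in.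
apply: gengrp_sub => {}g [r [t [t0 [/implyP tK ->]]]].
have nin x : (is_long r -> x \in K) -> gengrp (fun g => exists (r : rootT X) (t : L),
         (is_long r ==> (t \in K)) /\ g = ur N c r t) (nr N c r x).
  move=> xK; do 2?apply: gen_mul; apply: gen_in; [exists r, x|exists (oppR r), (- x^-1)|exists r, x];
    by rewrite ?is_long_oppR; split=> //; apply/implyP=> lr; rewrite ?rpredN ?rpredV xK.
by apply: gen_mul; apply: nin => // _; rewrite rpredN rpred1.
Qed.

End Groups.

(** * Roots and coroots of type B *)

Section TypeB.
Variable n : nat.
Notation X := (TB n).
Hypothesis HX : valid_type X.

Lemma longB (r : rootT X) : reflect (val r \in dd n) (is_long r).
Proof.
have n2 : (2 <= n)%N by [].
apply: (iffP (@is_longP X r)) => [h|].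
  have := rootTP r; rewrite mem_cat => /orP[/mem_axial [i [e [li /mem_pm he e1]]]|//].
  have hd : dvec n 0 1 1 1 \in rootsys X.
    by rewrite mem_cat; apply/orP; right; apply/mem_dd; exists 0, 1, 1, 1.
  have := h _ hd; rewrite dotv_dvec_dvec // e1 dotv_axv_axv //; case: he => ->; lia.
move/mem_dd => [i [j [a [b [lij lj /mem_pm ha /mem_pm hb ->]]]]] s.
rewrite dotv_dvec_dvec // mem_cat => /orP[/mem_axial|/mem_dd].
  move=> [k [e [lk /mem_pm he ->]]]; rewrite dotv_axv_axv //.
  by case: he => ->; case: ha => ->; case: hb => ->; lia.
move=> [k [l [e [g [lkl ll /mem_pm he /mem_pm hg ->]]]]]; rewrite dotv_dvec_dvec //.
case: he => ->; case: hg => ->; case: ha => ->; case: hb => ->; lia.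
Qed.

Lemma shortB (r : rootT X) : ~~ is_long r -> exists i e, [/\ (i < n)%N, e \in pm & val r = scalev e (ev n i)].
Proof.
move/longB => h; have := rootTP r; rewrite mem_cat => /orP[|//].
by move=> /mem_axial [i [e [li he e1]]]; exists i, e; split=> //; rewrite e1 mulr1.
Qed.

(** The coroot of a short root e_i is 2e_i, and roots have integral coordinates. *)
Lemma cartan_shortB (r s : rootT X) : ~~ is_long s -> (2 %| cartan (val r) (val s))%Z.
Proof.
move=> /shortB [i [e [li /mem_pm he es]]].
rewrite (_ : cartan _ _ = (e * nth 0 (val r) i) * 2) ?dvdz_mull //.
apply: (@cartan_uniq X); first exact: rootTP.
have zr := root_size (rootTP r).
by rewrite es dotv_axv_axv // dotv_axv //; case: he => ->; lia.
Qed.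

Lemma cartan_dvecB (s : rootT X) i j (a b : int) : (i < j)%N -> (j < n)%N -> a \in pm -> b \in pm ->
  cartan (val s) (dvec n i j a b) = a * nth 0 (val s) i + b * nth 0 (val s) j.
Proof.
move=> lij lj ha hb; apply: (@cartan_uniq X).
  by rewrite mem_cat; apply/orP; right; apply/mem_dd; exists i, j, a, b.
have zs := root_size (rootTP s); rewrite dotv_dvec_dvec // dotv_dvec //.
by move/mem_pm: ha => [] ->; move/mem_pm: hb => [] ->; lia.
Qed.

End TypeB.

(** * The individual types *)

Section PickProducts.
Variables (L : fieldType) (t : nat -> L).
Hypothesis t0 : forall i, t i != 0.

Lemma prod_expz_add m (F G : nat -> int) :
  \prod_(i < m) t i ^ (F i + G i) = (\prod_(i < m) t i ^ F i) * \prod_(i < m) t i ^ G i.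
Proof. by rewrite -big_split; apply: eq_bigr => i _; rewrite expfzDr. Qed.

Lemma prod_expz_pick m j (a : int) :
  \prod_(i < m) t i ^ (a * (i == j :> nat)%:R) = if (j < m)%N then t j ^ a else 1.
Proof.
case: ifP => lj.
  rewrite (bigD1 (Ordinal lj)) //= eqxx mulr1 big1 ?mulr1 // => i ne.
  by rewrite (_ : (i == j :> nat) = false) ?mulr0 //; apply/negbTE; rewrite -val_eqE in ne.
apply: big1 => i _; rewrite (_ : (i == j :> nat) = false) ?mulr0 //.
by apply/negbTE; apply/eqP => e; have := ltn_ord i; rewrite e lj.
Qed.

Lemma prod_expz_pick_succ m j (a : int) :
  \prod_(i < m) t i ^ (a * (i.+1 == j :> nat)%:R) = if (0 < j <= m)%N then t j.-1 ^ a else 1.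
Proof.
case: j => [|j] /=; first by apply: big1 => i _; rewrite mulr0.
by rewrite -prod_expz_pick; apply: eq_bigr => i _; rewrite eqSS.
Qed.

End PickProducts.

Lemma axv_notin_dd n i : (i < n)%N -> scalev 1 (ev n i) \notin dd n.
Proof.
move=> li; apply/negP => /mem_dd [a [b [e [f [lab lb /mem_pm he /mem_pm hf e1]]]]].
have := dotv_dvec_dvec e f lab lb; rewrite -e1 dotv_axv_axv //.
by case: he => ->; case: hf => ->.
Qed.

(** * Type B of odd rank n + 1 *)

Section TypeBTorus.
Variable n : nat.
Notation X := (TB n.+1).
Hypothesis n0 : (0 < n)%N.
Variables (L : fieldType) (K : divringClosed L).
Hypothesis Hfrob : forall x : L, x ^+ 2 \in K.

Lemma simplesB_lt i : (i < n)%N -> nth [::] (simples X) i = dvec n.+1 i i.+1 1 (-1).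
Proof.
move=> li; rewrite /= nth_cat size_map size_iota li (nth_map 0) ?size_iota // nth_iota //.
by rewrite add0n subv_ev.
Qed.

Lemma simplesB_last : nth [::] (simples X) n = scalev 1 (ev n.+1 n).
Proof.
by rewrite scale1v nth_cat size_map size_iota ltnn subnn.
Qed.

Lemma simple_long_oddB (t : 'I_(rank X) -> L) : ~~ odd n -> (forall i, t i != 0) ->
  (forall r : rootT X, is_long r -> simple_char t r \in K) ->
  forall i, is_long (simpleR i) -> t i \in K.
Proof.
move=> en t0 hK.
have HX : valid_type X by [].
pose u (i : nat) : L := t (inord i).
have u0 i : u i != 0 by exact: t0.
(* w k is t_{k-1}, with w 0 = w (n+1) = 1: modulo K, the long simple root a_k gives w_k w_{k+2}. *)
pose w k : L := if k is k'.+1 then (if (k' < n)%N then u k' else 1) else 1.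
have w0 k : w k != 0 by case: k => [|k] /=; [|case: ifP => _]; rewrite ?oner_eq0.
have step k : (k < n)%N -> w k * w k.+2 \in K.
  move=> lk; pose i : 'I_(rank X) := Ordinal (ltnW lk : (k < n.+1)%N).
  have ei : val (simpleR i) = dvec n.+1 k k.+1 1 (-1) by apply: simplesB_lt.
  have lr : is_long (simpleR i).
    by apply/longB => //; rewrite ei; apply/mem_dd; exists k, k.+1, 1, (-1).
  have := hK _ lr; rewrite /simple_char.
  have -> : \prod_j t j ^ cartan (val (simpleR i)) (simple_root j) =
     \prod_(j < n.+1) u j ^ (cartan (val (simpleR i)) (nth [::] (simples X) j)).
    by apply: eq_bigr => j _; rewrite /u inord_val.
  rewrite big_ord_recr /=.
  (* The row of the Cartan matrix as Kronecker deltas. The left neighbour is tested by [j.+1 == k],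
     which for k = 0 is correctly never satisfied. *)
  have cart j : (j < n)%N -> cartan (val (simpleR i)) (nth [::] (simples X) j) =
       (2 * (j == k)%:R + (-1) * (j.+1 == k)%:R) + (-1) * (j == k.+1)%:R.
    move=> lj; rewrite simplesB_lt // cartan_dvecB // ei !nth_dvec //.
    by do ?[case: eqP => ?]; lia.
  rewrite (eq_bigr (fun j : 'I_n => u j ^ ((2 * (j == k :> nat)%:R + (-1) * (j.+1 == k)%:R)
     + (-1) * (j == k.+1 :> nat)%:R))) => [|j _]; last by rewrite cart.
  rewrite (prod_expz_add u0 n (fun j => 2 * (j == k)%:R + (-1) * (j.+1 == k)%:R)
    (fun j => (-1) * (j == k.+1)%:R)).
  rewrite (prod_expz_add u0 n (fun j => 2 * (j == k)%:R) (fun j => (-1) * (j.+1 == k)%:R)).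
  rewrite !prod_expz_pick prod_expz_pick_succ lk.
  (* The last simple root is short, so its parameter occurs with an even exponent and contributes a
     factor in K. *)
  rewrite simplesB_last; have ck : (2 %| cartan (val (simpleR i)) (scalev 1 (ev n.+1 n)))%Z.
    have hin : scalev 1 (ev n.+1 n) \in rootsys X.
      by rewrite mem_cat; apply/orP; left; apply/mem_axial; exists n, 1; rewrite mulr1.
    apply: (@cartan_shortB n.+1 HX (simpleR i) (SeqSub hin)).
    by apply/longB => //; apply/negP; apply: axv_notin_dd.
  have cK : u n ^ cartan (val (simpleR i)) (scalev 1 (ev n.+1 n)) \in K.
    by case/dvdzP: ck => m ->; rewrite mulrC -exprz_exp exprz_in // Hfrob.
  have uK : u k ^ 2 \in K by apply: Hfrob.
  have -> : (if (0 < k <= n)%N then u k.-1 ^ (-1) else 1) = (w k)^-1.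
    by case: k lk {i ei lr cart ck cK uK} => [|k] lk /=; rewrite ?invr1 // (ltnW lk).
  have -> : (if (k.+1 < n)%N then u k.+1 ^ (-1) else 1) = (w k.+2)^-1.
    by rewrite /w; case: ifP; rewrite ?invr1.
  move=> hp; have uk0 := u0 k;
  have un0 := expfz_neq0 (cartan (val (simpleR i)) (scalev 1 (ev n.+1 n))) (u0 n).
  rewrite -rpredV; move: hp cK un0; set z := _ ^ cartan _ _ => hp cK z0.
  have -> : (w k * w k.+2)^-1 = (u k ^ 2 / w k / w k.+2 * z) / (u k ^ 2) / z.
    by field; rewrite z0 uk0 !w0.
  by rewrite !rpred_div // rpredM.
have wdiv k : (k < n)%N -> (w k \in K) = (w k.+2 \in K).
  move=> lk; have := step k lk => h; apply/idP/idP => hk.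
    by rewrite -(mulKf (w0 k) (w k.+2)) rpredM // rpredV.
  by rewrite -(mulfK (w0 k.+2) (w k)) rpred_div.
have evK k : (k.*2 <= n.+1)%N -> w k.*2 \in K.
  elim: k => [|k IH] lk; first exact: rpred1.
  by rewrite doubleS -wdiv ?IH //; lia.
(* Even indices are reached upwards from w_0 = 1. As n is even, n + 1 is odd, and w_{n+1} = 1 starts
   the descent through the odd indices; for n odd both ends would have even index. *)
have oddK k : (k.*2 <= n)%N -> w (n - k.*2).+1 \in K.
  elim: k => [|k IH] lk; first by rewrite subn0 /= ltnn rpred1.
  rewrite wdiv; last by lia.
  have -> : (n - k.+1.*2).+3 = (n - k.*2).+1 by lia.
  by apply: IH; lia.
have wK k : (k <= n.+1)%N -> w k \in K.
  move=> lk; have [ok|ek] := boolP (odd k).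
    have -> : k = (n - ((n.+1 - k)./2).*2).+1 by lia.
    by apply: oddK; lia.
  have -> : k = (k./2).*2 by lia.
  by apply: evK; lia.
move=> i /longB li; have [lt|ge] := ltnP i n.
  by have := wK i.+1 (ltnW lt); rewrite /= lt /u inord_val.
have lti : (i < n.+1)%N := ltn_ord i.
have ein : nat_of_ord i = n by lia.
have : val (simpleR i) \notin dd n.+1; last by rewrite li.
by rewrite [val _]/(simple_root i) /simple_root ein simplesB_last axv_notin_dd.
Qed.

End TypeBTorus.

(** * Type B of even rank: a character outside the generated group *)

Section EvenB.
Variable n : nat.
Notation X := (TB n).
Hypothesis HX : valid_type X.
Variables (N : rootT X -> rootT X -> int) (c : rootT X -> 'I_(rank X) -> int).
Hypothesis Hchev : is_chevalley_basis N c.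
Variables (L : fieldType) (K : divringClosed L).
Hypothesis Hfrob : forall x : L, x ^+ 2 \in K.

Lemma evenB_counterexample x : ~~ odd n -> x \notin K ->
  exists h, TKL N c K h /\ ~ Tgen N c K h.
Proof.
move=> en xK; have x0 : x != 0 by apply: contraNneq xK => ->; exact: rpred0.
have n0 : (0 < n)%N by exact: (ltnW HX).
(* f j is the product of the h_r(x) for r = e_{2i} + e_{2i+1}, i < j. *)
pose f j (s : rootT X) := x ^ (\sum_(i < j.*2) nth 0 (val s) i).
have fT j : (j.*2 <= n)%N -> TL N c (torus (f j)).
  elim: j => [|j IH] lj.
    rewrite (_ : torus _ = 1%:M); first exact: gen_one.
    by rewrite -torus1; apply: eq_torus => s; rewrite /f big_ord0 expr0z.
  have lj1 : (j.*2.+1 < n)%N by [].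
  have rin : dvec n j.*2 j.*2.+1 1 1 \in rootsys X.
    by rewrite mem_cat; apply/orP; right; apply/mem_dd; exists j.*2, j.*2.+1, 1, 1.
  have hin : TL N c (hr N c (SeqSub rin) x) by apply: gen_in; exists (SeqSub rin), x.
  have := gen_mul (IH (ltnW (ltnW lj))) hin; rewrite (hrE HX Hchev) // torusM.
  congr (TL N c); apply: eq_torus => s; rewrite /f doubleS !big_ord_recr /= -!expfzDr //; congr (_ ^ _).
  by rewrite -addrA; congr (_ + _); rewrite cartan_dvecB // !mul1r.
have [m em] : exists m, n = m.*2 by exists n./2; lia.
exists (torus (f m)); have hT := fT m (eq_leq (esym em)).
have fE s : f m s = x ^ (\sum_(i < n) nth 0 (val s) i) by rewrite /f -em.
have [g [eg cg _]] := TL_char HX Hchev hT.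
have gf := torus_inj eg.
split.
  rewrite eg; apply: long_TKL => [|//|r /longB lr]; first by rewrite -eg.
  rewrite -gf fE; apply: (@exprz_char_in X _ _ Hfrob).
  have /mem_dd [i [j [a [b [lij lj ha hb ->]]]]] := lr HX.
  rewrite sum_dvec //.
  by move/mem_pm: ha => [] ->; move/mem_pm: hb => [] ->.
move=> hG; have ein : scalev 1 (ev n 0) \in rootsys X.
  by rewrite mem_cat; apply/orP; left; apply/mem_axial; exists 0, 1; rewrite mulr1.
pose e0 : rootT X := SeqSub ein.
(* The value of h_r(t) at e_1 is a power of t, with t in K if r is long and with even exponent if r
   is short; it lies in K either way, whereas here it is x. *)
have [f' [ef' _ f'K]] : torus_in (fun f => f e0 \in K) (torus (f m)).
  apply: gengrp_torus hG => [h [r [t [t0 [/implyP tK ->]]]]||f1 f2 _ _ h1 h2|f1 _ h1].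
  - apply: (torus_gen_in HX Hchev) => //; have [lr|sr] := boolP (is_long r).
      by apply: exprz_in; apply: tK.
    by apply: (@exprz_char_in X _ _ Hfrob); apply: cartan_shortB.
  - exact: rpred1.
  - exact: rpredM.
  by rewrite rpredV.
move: f'K xK; rewrite -(torus_inj ef') fE /= (bigD1 (Ordinal n0)) //= nth_axv // mulr1.
rewrite big1 ?addr0 ?expr1z => [->//|k ne].
by rewrite nth_axv // (_ : (k == 0 :> nat) = false) // ?mulr0 //; apply/negbTE; rewrite -val_eqE in ne.
Qed.

End EvenB.

(** * Type C: coroots and the counterexample *)

Section TypeC.
Variable n : nat.
Notation X := (TC n).
Hypothesis HX : valid_type X.

Lemma axC_in i : (i < n)%N -> scalev 2 (ev n i) \in rootsys X.
Proof. by move=> li; rewrite mem_cat; apply/orP; left; apply/mem_axial; exists i, 1; rewrite mul1r. Qed.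

Lemma axC_long (r : rootT X) : val r \in axial n 2 -> is_long r.
Proof.
move/mem_axial => [i [e [li /mem_pm he er]]]; apply/is_longP => s.
rewrite er dotv_axv_axv // mem_cat => /orP[/mem_axial|/mem_dd].
  move=> [j [e' [lj /mem_pm he' ->]]]; rewrite dotv_axv_axv //.
  by case: he => ->; case: he' => ->.
move=> [k [l [a [b [lkl ll /mem_pm ha /mem_pm hb ->]]]]]; rewrite dotv_dvec_dvec //.
by case: he => ->; case: ha => ->; case: hb => ->.
Qed.

Lemma longC (r : rootT X) : is_long r -> val r \in axial n 2.
Proof.
have n0 : (0 < n)%N by exact: (ltnW HX).
move/is_longP => /(_ _ (axC_in n0)); rewrite dotv_axv_axv //.
have := rootTP r; rewrite mem_cat => /orP[//|/mem_dd].
move=> [k [l [a [b [lkl ll /mem_pm ha /mem_pm hb ->]]]]]; rewrite dotv_dvec_dvec //.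
by case: ha => ->; case: hb => ->.
Qed.

(* The i-th standard coordinate of the coroot of s. *)
Definition corootC (s : rootT X) (i : nat) : int :=
  if is_long s then (nth 0 (val s) i %/ 2)%Z else nth 0 (val s) i.

Lemma cartan_axC (s : rootT X) i : (i < n)%N -> cartan (scalev 2 (ev n i)) (val s) = 2 * corootC s i.
Proof.
move=> li; apply: (@cartan_uniq X); first exact: rootTP.
have zs : size (val s) = n := root_size (rootTP s).
rewrite (dotvZl 2) ?size_ev // dotvC ?size_ev // dotv_ev // /corootC.
case: ifP => [/longC|/negbT sl].
  move/mem_axial => [j [e [lj /mem_pm he ->]]]; rewrite dotv_axv_axv // nth_axv //.
  by case: he => ->; case: eqP.
have := rootTP s; rewrite mem_cat => /orP[/axC_long ls|]; first by rewrite ls in sl.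
move/mem_dd=> [k [l [a [b [lkl ll /mem_pm ha /mem_pm hb ->]]]]]; rewrite dotv_dvec_dvec //.
by case: ha => ->; case: hb => ->; lia.
Qed.

Lemma sum_corootC (s : rootT X) : ~~ is_long s -> (2 %| \sum_(i < n) corootC s i)%Z.
Proof.
move=> sl; rewrite /corootC (negbTE sl).
have := rootTP s; rewrite mem_cat => /orP[/axC_long ls|]; first by rewrite ls in sl.
move/mem_dd=> [i [j [a [b [lij lj /mem_pm ha /mem_pm hb ->]]]]].
rewrite sum_dvec //.
by case: ha => ->; case: hb => ->.
Qed.

Variables (N : rootT X -> rootT X -> int) (c : rootT X -> 'I_(rank X) -> int).
Hypothesis Hchev : is_chevalley_basis N c.
Variables (L : fieldType) (K : divringClosed L).
Hypothesis Hfrob : forall x : L, x ^+ 2 \in K.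

Lemma C_counterexample x : x \notin K -> exists h, TKL N c K h /\ ~ Tgen N c K h.
Proof.
move=> xK; have x0 : x != 0 by apply: contraNneq xK => ->; exact: rpred0.
have n0 : (0 < n)%N by exact: (ltnW HX).
pose a (i : 'I_n) : rootT X := SeqSub (axC_in (ltn_ord i)).
pose a0 := a (Ordinal n0).
have hT : TL N c (hr N c a0 x) by apply: gen_in; exists a0, x.
exists (hr N c a0 x); split.
  have cg := root_char_exp a0 x0; rewrite (hrE HX Hchev) // in hT *.
  apply: long_TKL => // r /longC/mem_axial [i [e [li he er]]].
  apply: (@exprz_char_in X _ _ Hfrob).
  have [->|->] : val r = val (a (Ordinal li)) \/ val r = oppv (val (a (Ordinal li))).
    rewrite er /=; move/mem_pm: he => [] ->; [left; by rewrite mul1r | right].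
    by rewrite oppv_axv // mulN1r.
  - by rewrite cartan_axC // dvdz_mulr.
  by rewrite (@cartan_opp X) ?rootTP // cartan_axC // -mulrN dvdz_mulr.
move=> hG.
(* One value is not enough: for the short root r = e_1 - e_2 and t in L, h_r(t) already takes the
   value t^2 at 2e_1. In the product over all 2e_i a generator gives the square of t^(sum of coroot
   coordinates), where this sum is even for short roots, so the base lies in K. For h_{2e_1}(x) the
   product is x^2, whose roots x and -x are outside K. *)
have [f [ef _ [k kK ek]]] : torus_in (fun f => exists2 k, k \in K & \prod_i f (a i) = k ^+ 2) (hr N c a0 x).
  apply: gengrp_torus hG => [h [s [t [t0 [/implyP tK ->]]]]||f1 f2 _ _ [k1 K1 e1] [k2 K2 e2]|f1 _ [k1 K1 e1]].
  - apply: (torus_gen_in HX Hchev) => //; exists (t ^ (\sum_(i < n) corootC s i)).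
      have [ls|ss] := boolP (is_long s); first by apply: exprz_in; apply: tK.
      by apply: (@exprz_char_in X _ _ Hfrob); apply: sum_corootC.
    rewrite (big_morph _ (fun a b => expfzDr a b t0) (expr0z t)) -prodrXl.
    by apply: eq_bigr => i _; rewrite cartan_axC // mulrC -exprz_exp.
  - by exists 1; rewrite ?rpred1 // expr1n big1.
  - by exists (k1 * k2); rewrite ?rpredM // big_split /= e1 e2 exprMn.
  by exists k1^-1; rewrite ?rpredV // prodfV e1 exprVn.
have := ek; rewrite (eq_bigr (fun i : 'I_n => x ^ (2 * corootC a0 i))) => [|i _]; last first.
  have fe := torus_inj (etrans (esym ef) (hrE HX Hchev a0 x0)).
  by rewrite fe cartan_axC.
have ls : is_long a0 by apply: axC_long; apply/mem_axial; exists 0, 1; rewrite mul1r.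
rewrite (bigD1 (Ordinal n0)) //= big1 => [|i ne]; last first.
  rewrite /corootC ls /= nth_axv // (_ : (i == 0 :> nat) = false) //.
  by apply/negbTE; rewrite -val_eqE in ne.
rewrite /corootC ls /= nth_axv // mulr1 => /eqP; rewrite (_ : 2 * (2 * true%:R %/ 2)%Z = 2) //.
rewrite -[x ^ 2]/(x ^+ 2) eqf_sqr => /orP[] /eqP e; move: xK; rewrite e ?rpredN kK //.
Qed.

End TypeC.

(** * The exceptional types G_2 and F_4, by computation with explicit roots *)

Definition cartanf (b a : seq int) : int := ((2 * dotf b a) %/ dotf a a)%Z.

Lemma cartanfE b a : cartan b a = cartanf b a.
Proof. by rewrite /cartan !dotf_dotv. Qed.

Lemma fin_long X (M : int) (r : rootT X) : all (fun s => dotf s s <= M) (rootsys X) ->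
  has (fun s => dotf s s == M) (rootsys X) -> is_long r = (dotf (val r) (val r) == M).
Proof.
move=> /allP h /hasP [s0 hs0 /eqP e0]; apply/is_longP/eqP => [lr|e s hs].
  apply/eqP; rewrite eq_le h ?rootTP //=; have := lr _ hs0; by rewrite !dotf_dotv e0.
by rewrite !dotf_dotv e h.
Qed.

Lemma fin_short_dvd X (M p : int) : (forall r : rootT X, is_long r = (dotf (val r) (val r) == M)) ->
  all (fun r => (dotf r r == M) ==> all (fun s => (dotf s s != M) ==> (p %| cartanf r s)%Z) (rootsys X))
      (rootsys X) ->
  forall r s : rootT X, is_long r -> ~~ is_long s -> (p %| cartan (val r) (val s))%Z.
Proof.
move=> E /allP h r s; rewrite !E => lr ss.
have := h _ (rootTP r); rewrite lr => /allP /(_ _ (rootTP s)); rewrite ss cartanfE; exact.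
Qed.

Lemma long_G2 (r : rootT TG2) : is_long r = (dotf (val r) (val r) == 6).
Proof. by apply: fin_long; vm_compute. Qed.

Lemma long_F4 (r : rootT TF4) : is_long r = (dotf (val r) (val r) == 8).
Proof. by apply: fin_long; vm_compute. Qed.

Section SimpleFinite.
Variables (L : fieldType) (K : divringClosed L).

Lemma prod_ord2 (F : 'I_2 -> L) : \prod_i F i = F (@Ordinal 2 0 isT) * F (@Ordinal 2 1 isT).
Proof. by rewrite !big_ord_recl big_ord0 mulr1; congr (F _ * F _); apply: val_inj. Qed.

Lemma prod_ord4 (F : 'I_4 -> L) : \prod_i F i =
  F (@Ordinal 4 0 isT) * (F (@Ordinal 4 1 isT) * (F (@Ordinal 4 2 isT) * F (@Ordinal 4 3 isT))).
Proof.
by rewrite !big_ord_recl big_ord0 mulr1; congr (F _ * (F _ * (F _ * F _))); apply: val_inj.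
Qed.

Lemma simple_long_G2 (Hfrob : forall x : L, x ^+ 3 \in K) (t : 'I_(rank TG2) -> L) : (forall i, t i != 0) ->
  (forall r : rootT TG2, is_long r -> simple_char t r \in K) ->
  forall i, is_long (simpleR i) -> t i \in K.
Proof.
move=> t0 hK; pose i0 : 'I_(rank TG2) := (@Ordinal 2 0 isT); pose i1 : 'I_(rank TG2) := (@Ordinal 2 1 isT).
have E r : simple_char t r = t i0 ^ cartan (val r) (simple_root i0) * t i1 ^ cartan (val r) (simple_root i1).
  exact: (prod_ord2 (fun i => t i ^ cartan (val r) (@simple_root TG2 i))).
have t1K : t i1 \in K.
  have l1 : is_long (simpleR i1) by rewrite long_G2.
  have := hK _ l1; rewrite E !cartanfE.
  rewrite (_ : cartanf _ _ = - 3%:Z); last by vm_compute.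
  rewrite (_ : cartanf (val _) _ = 2%:Z); last by vm_compute.
  rewrite -exprnN => h.
  (* The long simple root gives t_0^{-3} t_1^2 in K. Cubes are in K, so t_1^2 is too, and t_1 is the
     quotient of t_1^3 by it. *)
  have -> : t i1 = t i1 ^+ 3 / t i0 ^+ 3 / (t i0 ^- 3 * t i1 ^ 2).
    by rewrite -[t i1 ^ 2]/(t i1 ^+ 2); field; rewrite !t0.
  by rewrite !rpred_div.
move=> -[[|[|//]] hi]; first by rewrite long_G2.
by move=> _; rewrite (_ : Ordinal hi = i1) //; apply: val_inj.
Qed.

Lemma simple_long_F4 (Hfrob : forall x : L, x ^+ 2 \in K) (t : 'I_(rank TF4) -> L) : (forall i, t i != 0) ->
  (forall r : rootT TF4, is_long r -> simple_char t r \in K) ->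
  forall i, is_long (simpleR i) -> t i \in K.
Proof.
move=> t0 hK.
pose i0 : 'I_(rank TF4) := (@Ordinal 4 0 isT); pose i1 : 'I_(rank TF4) := (@Ordinal 4 1 isT).
pose i2 : 'I_(rank TF4) := (@Ordinal 4 2 isT); pose i3 : 'I_(rank TF4) := (@Ordinal 4 3 isT).
have E r : simple_char t r =
  t i0 ^ cartanf (val r) (simple_root i0) * (t i1 ^ cartanf (val r) (simple_root i1)
    * (t i2 ^ cartanf (val r) (simple_root i2) * t i3 ^ cartanf (val r) (simple_root i3))).
  rewrite -!cartanfE; exact: (prod_ord4 (fun i => t i ^ cartan (val r) (@simple_root TF4 i))).
(* The long simple roots span an A_2, whose Cartan matrix modulo 2 exchanges the two coordinates: up
   to squares the first root isolates t_1 and the second isolates t_0. *)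
have t1K : t i1 \in K.
  have l0 : is_long (simpleR i0) by rewrite long_F4.
  have := hK _ l0; rewrite E.
  have -> : cartanf (val (simpleR i0)) (simple_root i0) = 2 by vm_compute.
  have -> : cartanf (val (simpleR i0)) (simple_root i1) = -1 by vm_compute.
  have -> : cartanf (val (simpleR i0)) (simple_root i2) = 0 by vm_compute.
  have -> : cartanf (val (simpleR i0)) (simple_root i3) = 0 by vm_compute.
  rewrite !expr0z !mulr1 => h.
  have -> : t i1 = t i0 ^+ 2 / (t i0 ^ 2 * t i1 ^ (-1)).
    by rewrite -[t i0 ^ 2]/(t i0 ^+ 2) -[t i1 ^ (-1)]/((t i1)^-1); field; rewrite !t0.
  by rewrite rpred_div.
have t0K : t i0 \in K.
  have l1 : is_long (simpleR i1) by rewrite long_F4.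
  have := hK _ l1; rewrite E.
  have -> : cartanf (val (simpleR i1)) (simple_root i0) = -1 by vm_compute.
  have -> : cartanf (val (simpleR i1)) (simple_root i1) = 2 by vm_compute.
  have -> : cartanf (val (simpleR i1)) (simple_root i2) = -2%:Z by vm_compute.
  have -> : cartanf (val (simpleR i1)) (simple_root i3) = 0 by vm_compute.
  rewrite !expr0z !mulr1 -exprnN => h.
  have -> : t i0 = t i1 ^+ 2 / t i2 ^+ 2 / (t i0 ^ (-1) * (t i1 ^ 2 / t i2 ^+ 2)).
    by rewrite -[t i1 ^ 2]/(t i1 ^+ 2) -[t i0 ^ (-1)]/((t i0)^-1); field; rewrite !t0.
  by rewrite !rpred_div.
move=> -[[|[|[|[|//]]]] hi]; rewrite ?long_F4 // => _.
- by rewrite (_ : Ordinal hi = i0) //; apply: val_inj.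
by rewrite (_ : Ordinal hi = i1) //; apply: val_inj.
Qed.

End SimpleFinite.

Theorem mainTheorem2
  (X : ctype) (HX : valid_type X)
  (N : rootT X -> rootT X -> int) (c : rootT X -> 'I_(rank X) -> int)
  (Hchev : is_chevalley_basis N c)
  (L : fieldType) (K : divringClosed L)
  (Hchar : char_of X \in [pchar L])
  (Hproper : exists x : L, x \notin K)
  (Hfrob : forall x : L, x ^+ char_of X \in K) :
  ((forall h, TKL N c K h <-> Tgen N c K h) <->
     (X = TG2 \/ X = TF4 \/ exists n, X = TB n /\ odd n)) /\
  ((X = TG2 \/ X = TF4 \/ exists n, X = TB n /\ odd n) ->
     forall g, XKL N c K g <-> Ugen N c K g).
Proof.
have good : (X = TG2 \/ X = TF4 \/ exists n, X = TB n /\ odd n) ->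
    forall h, TKL N c K h <-> Tgen N c K h.
  move=> hX h; split.
    apply: (TKL_Tgen HX Hchev) => t t0 hK.
    case: hX => [e|[e|[n [e on]]]]; subst X.
    - exact: simple_long_G2.
    - exact: simple_long_F4.
    move: {N c Hchev Hchar h} HX Hfrob t t0 hK.
    case: n on => [//|n] on HX' Hfrob' t t0 hK; exact: simple_long_oddB.
  apply: (Tgen_TKL HX Hchev Hfrob) => r s lr ss.
  case: hX => [e|[e|[n [e on]]]]; subst X.
  - by apply: (fin_short_dvd long_G2) lr ss; vm_compute.
  - by apply: (fin_short_dvd long_F4) lr ss; vm_compute.
  exact: cartan_shortB.
split; last by move=> hX; apply: (XKL_Ugen (fun h => (good hX h).1)).
split=> [eqT|]; last exact: good.
have [x xK] := Hproper.
case: X HX N c Hchev Hchar Hfrob eqT {good} => [n|n||] HX N c Hchev Hchar Hfrob eqT.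
- right; right; exists n; split=> //; apply/negP => /negP en.
  by have [h [/eqT]] := evenB_counterexample HX Hchev Hfrob en xK.
- by have [h [/eqT]] := C_counterexample HX Hchev Hfrob xK.
- by right; left.
by left.
Qed.
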